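(* Let $G=(V,E)$ be a finite simple graph with a maximal adjacency ordering $<$, with vertices identified with $1,\dots,n$ according to $<$; let $m=|E|$. Let $s>1$ be a vertex and $k$ a positive integer at most the number of neighbours of $s$ in $\{1,\dots,s-1\}$. For $i\in\{1,\dots,k\}$ let $T_i$ be the connected component of the forest $(V,F_i)$ containing $s$, and let $r_i$ be the smallest vertex of $T_i$. (i) (Fan variant) Let $T=\{t_1,\dots,t_k\}\subseteq V$ be such that $r_i\le t_i<s$ for every $i$. Then $k$ internally vertex-disjoint paths between $s$ and $T$ can be computed in time $O(|E(T_1\cup\dots\cup T_k)|)\subseteq O(n+m)$. (ii) (Set variant) Let $T=\{t_1,\dots,t_k\}$ and $S=\{s_1,\dots,s_k\}$ be disjoint vertex sets such that $r_i\le t_i<s$ and $r_i\le s_i\le s$ for every $i$. Then $k$ internally vertex-disjoint paths between $S$ and $T$ can be computed in time $O(|E(T_1\cup\dots\cup T_k)|)\subseteq O(n+m)$.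
   Context: A maximal adjacency ordering (MAO) of $G$ is a total order $1,\dots,n$ on $V$ such that for every two vertices $v<w$, the number of neighbours of $v$ in $\{1,\dots,v-1\}$ is at least the number of neighbours of $w$ in $\{1,\dots,v-1\}$. Forest decomposition: for each vertex $v>1$ with neighbours $w_1<\dots<w_l$ in $\{1,\dots,v-1\}$, the edge $\{w_i,v\}$ is put into the edge set $F_i$ for $i=1,\dots,l$; each $(V,F_i)$ is a forest. Paths between a vertex and a set (resp. two sets) are understood in the sense of Menger's theorem: $k$ paths from $s$ to distinct vertices of $T$ sharing only $s$ (resp. $k$ vertex-disjoint paths each from a vertex of $S$ to a vertex of $T$). *)

(* Defs.v *)
(* MathComp only.  Vertices, forest indices and array cells are all numbered
   from 0: vertex v : 'I_n is the (v+1)-st vertex of the ordering, and index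
   i : 'I_k stands for i+1 in {1, ..., k}. *)
From mathcomp Require Import all_boot.

Set Implicit Arguments.
Unset Strict Implicit.
Unset Printing Implicit Defensive.

Section Graphs.

Variable n : nat.
Implicit Types (e : rel 'I_n) (s u v w : 'I_n) (i k : nat).

(* As [enum 'I_n] is increasing, this is the list w_1 < ... < w_l. *)
Definition left_nbrs e v : seq 'I_n :=
  [seq w : 'I_n <- enum 'I_n | (w < v) && e v w].

Definition MAO e : Prop :=
  forall v w, v < w ->
    #|[set x : 'I_n | (x < v) && e w x]| <= #|[set x : 'I_n | (x < v) && e v x]|.

Definition edges e : {set {set 'I_n}} :=
  [set [set u; v] | u in 'I_n, v in 'I_n & e u v].

(* Adjacency in the forest (V, F_(i+1)). *)
Definition forest e i : rel 'I_n :=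
  fun u v => (onth (left_nbrs e v) i == Some u)
          || (onth (left_nbrs e u) i == Some v).

Definition tree e s i : {set 'I_n} := [set v | connect (forest e i) s v].

Definition tree_root e s i : 'I_n := [arg min_(v < s in tree e s i) val v].

Definition tree_edges e s i : {set {set 'I_n}} :=
  edges (fun u v => (u \in tree e s i) && forest e i u v).

(* E(T_1 \cup ... \cup T_k) *)
Definition trees_edges e s k : {set {set 'I_n}} :=
  \bigcup_(i < k) tree_edges e s i.

Definition is_path e u v (p : seq 'I_n) : Prop :=
  if p is x :: q then [/\ x = u, path e x q, last x q = v & uniq p] else False.

(* k paths from s to T, any two of which share s and no other vertex (so that,
   as s is not in T, their end vertices in T are distinct). *)
Definition fan e s (T : seq 'I_n) k (ps : seq (seq 'I_n)) : Prop :=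
  [/\ size ps = k,
      forall p, p \in ps -> exists2 v, v \in T & is_path e s v p
    & forall i j, i < j < k ->
        forall x, x \in nth [::] ps i -> x \in nth [::] ps j -> x = s].

(* k pairwise vertex-disjoint paths, each from S to T. *)
Definition linkage e (S T : seq 'I_n) k (ps : seq (seq 'I_n)) : Prop :=
  [/\ size ps = k,
      forall p, p \in ps ->
        exists2 u, u \in S & exists2 v, v \in T & is_path e u v p
    & forall i j, i < j < k ->
        forall x, x \in nth [::] ps i -> x \in nth [::] ps j -> False].

End Graphs.

(* The machine model is the unit-cost word RAM, with structured programs.  A
   program names a fixed finite number of registers and (arbitrarily long)
   arrays; an array is accessed at a computed index in one step. *)

Record state := State { reg : nat -> nat; arr : nat -> nat -> nat }.

Inductive expr :=
  | Const of nat
  | Reg of nat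
  | Get of nat & expr              (* [Get a e]: cell e of array a *)
  | Add of expr & expr
  | Sub of expr & expr.            (* truncated at 0 *)

Inductive test :=
  | Lt of expr & expr
  | Eq of expr & expr
  | Not of test.

Inductive cmd :=
  | Skip
  | SetReg of nat & expr
  | Put of nat & expr & expr       (* [Put a e f]: cell e of array a := f *)
  | Then of cmd & cmd
  | If of test & cmd & cmd
  | While of test & cmd.

Definition upd (T : Type) (f : nat -> T) (x : nat) (y : T) : nat -> T :=
  fun z => if z == x then y else f z.

Definition set_reg (st : state) x v : state := State (upd (reg st) x v) (arr st).

Definition set_arr (st : state) a x v : state :=
  State (reg st) (upd (arr st) a (upd (arr st a) x v)).

(* Words are the numbers below W; an overflowing computation is undefined. *)
Definition word (W v : nat) : option nat := if v < W then Some v else None.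

Fixpoint eval (W : nat) (st : state) (f : expr) : option nat :=
  match f with
  | Const c => word W c
  | Reg x => word W (reg st x)
  | Get a g => if eval W st g is Some i then word W (arr st a i) else None
  | Add g h => if (eval W st g, eval W st h) is (Some v, Some w)
               then word W (v + w) else None
  | Sub g h => if (eval W st g, eval W st h) is (Some v, Some w)
               then word W (v - w) else None
  end.

Fixpoint eval_test (W : nat) (st : state) (b : test) : option bool :=
  match b with
  | Lt g h => if (eval W st g, eval W st h) is (Some v, Some w)
              then Some (v < w) else None
  | Eq g h => if (eval W st g, eval W st h) is (Some v, Some w)
              then Some (v == w) else None
  | Not c => if eval_test W st c is Some v then Some (~~ v) else None
  end.

Fixpoint cost (f : expr) : nat :=
  match f with
  | Const _ | Reg _ => 1
  | Get _ g => (cost g).+1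
  | Add g h | Sub g h => (cost g + cost h).+1
  end.

Fixpoint cost_test (b : test) : nat :=
  match b with
  | Lt g h | Eq g h => (cost g + cost h).+1
  | Not c => (cost_test c).+1
  end.

(* [exec W P st tm st']: with word bound W, the program P started in state st
   halts without overflow in state st' after tm elementary steps. *)
Inductive exec (W : nat) : cmd -> state -> nat -> state -> Prop :=
  | ExecSkip st : exec W Skip st 1 st
  | ExecSetReg st x f v :
      eval W st f = Some v ->
      exec W (SetReg x f) st (cost f).+1 (set_reg st x v)
  | ExecPut st a f g i v :
      eval W st f = Some i -> eval W st g = Some v ->
      exec W (Put a f g) st (cost f + cost g).+1 (set_arr st a i v)
  | ExecThen st1 st2 st3 P Q tm1 tm2 :
      exec W P st1 tm1 st2 -> exec W Q st2 tm2 st3 ->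
      exec W (Then P Q) st1 (tm1 + tm2) st3
  | ExecIf st st' b v P Q tm :
      eval_test W st b = Some v -> exec W (if v then P else Q) st tm st' ->
      exec W (If b P Q) st (cost_test b + tm) st'
  | ExecWhileEnd st b P :
      eval_test W st b = Some false ->
      exec W (While b P) st (cost_test b) st
  | ExecWhileStep st1 st2 st3 b P tm1 tm2 :
      eval_test W st1 b = Some true ->
      exec W P st1 tm1 st2 -> exec W (While b P) st2 tm2 st3 ->
      exec W (While b P) st1 (cost_test b + tm1 + tm2) st3.

(* The given values occupy the first registers and arrays; every other
   register and array cell is initially 0. *)
Definition init_state (rs : seq nat) (xs : seq (seq nat)) : state :=
  State (fun x => nth 0 rs x) (fun a i => nth 0 (nth [::] xs a) i).

(* A list of lists is stored in two arrays: the concatenation of the lists, and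
   the offsets at which they start, followed by the total length. *)
Definition offsets (xss : seq (seq nat)) : seq nat :=
  [seq sumn (take j (shape xss)) | j <- iota 0 (size xss).+1].

Definition holds_lists (st : state) (a b : nat) (xss : seq (seq nat)) : Prop :=
  (forall j, j <= size xss -> arr st a j = nth 0 (offsets xss) j) /\
  (forall i, i < size (flatten xss) -> arr st b i = nth 0 (flatten xss) i).

(* The ordered graph is represented by the sorted lists of left neighbours,
   i.e. by its forest decomposition: the i-th entry of the list of v is the
   other end of the edge that v contributes to F_i. *)
Definition nbr_lists n (e : rel 'I_n) : seq (seq nat) :=
  [seq map val (left_nbrs e v) | v <- enum 'I_n].

(* Registers 0, 1, 2 hold n, k, s; arrays 0, 1 hold the graph; the further
   arrays 2, 3, ... hold the lists [ts]. *)
Definition input n (e : rel 'I_n) (k : nat) (s : 'I_n) (ts : seq (seq 'I_n)) :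
    state :=
  init_state [:: n; k; val s]
    [:: offsets (nbr_lists e), flatten (nbr_lists e) & map (map val) ts].

(* Arrays 4 and 5 hold the output.  The word bound C * (n + m + 1) amounts to
   words of log(n + m) + O(1) bits. *)
Definition outputs_paths n (e : rel 'I_n) (P : cmd) (C : nat) (st : state)
    (time : nat) (good : seq (seq 'I_n) -> Prop) : Prop :=
  exists tm st' ps,
    [/\ exec (C * (n + #|edges e|).+1) P st tm st', tm <= time, good ps
      & holds_lists st' 4 5 (map (map val) ps)].

(* Main.v *)
(* Write w_c(x) for the c-th left neighbour of x, so that F_c consists of the
   edges {x, w_c(x)}, and l(x) for the number of left neighbours of x.  The
   ordering enters only through: if w_c(x) < v < x then c <= l(v).

   Each of the two ends (the source, either s itself or S, and the target T) owns
   one thread per colour c in 1..k.  A started thread of colour c that was last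
   settled at x points at w_c(x).  The vertices v = s, s-1, ... are swept
   downwards; when v is reached, every thread points at a vertex <= v.  If
   several threads of one end, of colours c_1 < ... < c_q, point at v, the first
   one settles at v and takes colour c_q, while each other thread is redirected
   from its vertex x, from w_(c_i)(x) = v to w_(c_(i-1))(x) < v, and takes colour
   c_(i-1): the set of colours in use does not change.  If only one end has
   settled at v, its thread goes on with its new colour, which is at most l(v)
   because the thread of that colour of the other end points below v.  If both
   ends have settled at v, with colours c and d, the two threads form a finished
   path; the larger of c and d is retired at both ends, and if c <> d the thread
   of the other end that had the larger colour is redirected to the smaller one.

   A start vertex, when it is reached, gets the largest colour not yet started.
   This is at most the number of start vertices <= v, and the condition r_i <= t_i
   yields #{i | t_i < v} <= l(v), so an unstarted colour is never too large.

   The colours alive after v has been processed are at most l(v), so the sweep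
   scans at v only min(k, l(s), ..., l(v+1)) colours; these numbers add up to
   O(|E(T_1 u ... u T_k)|), since colour c is scanned at v only if all vertices
   of (v, s] are in T_c and have a left neighbour in F_c. *)

Require Import Defs.
From mathcomp Require Import all_boot zify.

Set Implicit Arguments.
Unset Strict Implicit.
Unset Printing Implicit Defensive.

(** * Evaluation and time of programs *)

Fixpoint ev (st : state) (f : expr) : nat :=
  match f with
  | Const c => c
  | Reg x => reg st x
  | Get a g => arr st a (ev st g)
  | Add g h => ev st g + ev st h
  | Defs.Sub g h => ev st g - ev st h
  end.

(** Every intermediate value is a word. Under [Sub] nothing is asked of the result: truncated
    subtraction never exceeds its first argument. *)
Fixpoint safe (W : nat) (st : state) (f : expr) : Prop :=
  match f with
  | Const c => c < W
  | Reg x => reg st x < W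
  | Get a g => safe W st g /\ arr st a (ev st g) < W
  | Add g h => [/\ safe W st g, safe W st h & ev st g + ev st h < W]
  | Defs.Sub g h => safe W st g /\ safe W st h
  end.

Fixpoint ev_test (st : state) (b : test) : bool :=
  match b with
  | Lt g h => ev st g < ev st h
  | Eq g h => ev st g == ev st h
  | Not c => ~~ ev_test st c
  end.

Fixpoint safe_test (W : nat) (st : state) (b : test) : Prop :=
  match b with
  | Lt g h | Eq g h => safe W st g /\ safe W st h
  | Not c => safe_test W st c
  end.

Lemma evalE W st f : safe W st f -> eval W st f = Some (ev st f) /\ ev st f < W.
Proof.
elim: f => [c|x|a f IH|f IHf g IHg|f IHf g IHg] /=.
- by rewrite /word => ->.
- by rewrite /word => ->.
- by case=> /IH[-> _]; rewrite /word => ->.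
- by case=> /IHf[-> _] /IHg[-> _]; rewrite /word => ->.
- case=> /IHf[-> fW] /IHg[-> _]; rewrite /word.
  by have -> : ev st f - ev st g < W by lia.
Qed.

Lemma eval_testE W st b : safe_test W st b -> eval_test W st b = Some (ev_test st b).
Proof.
elim: b => [f g|f g|b IH] /=; last by move/IH->.
- by case=> /evalE[-> _] /evalE[-> _].
- by case=> /evalE[-> _] /evalE[-> _].
Qed.

(** Total correctness with a time bound: halting and absence of overflow are part of the claim,
    while [t] is only an upper bound. *)
Definition wp W P t (Q : state -> Prop) st : Prop :=
  exists tm st', [/\ exec W P st tm st', tm <= t & Q st'].

Lemma wp_weaken W P t t' (Q Q' : state -> Prop) st : wp W P t Q st -> t <= t' ->
  (forall st', Q st' -> Q' st') -> wp W P t' Q' st.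
Proof. by case=> tm [st' [ex le q]] le' QQ'; exists tm, st'; split; [|lia|auto]. Qed.

Lemma wp_le W P t t' (Q : state -> Prop) st :
  wp W P t Q st -> t <= t' -> wp W P t' Q st.
Proof. by move=> w le; apply: wp_weaken w le _. Qed.

Lemma wp_then W P P' t t' Q st :
  wp W P t (wp W P' t' Q) st -> wp W (Then P P') (t + t') Q st.
Proof.
case=> tm [st1 [ex le [tm' [st2 [ex' le' q]]]]].
by exists (tm + tm'), st2; split=> //; [apply: ExecThen ex ex' | lia].
Qed.

Lemma cost_test_gt0 b : 0 < cost_test b.
Proof. by case: b. Qed.

(* The invariant is indexed by the time that is left. *)
Lemma wp_while W b P (I : nat -> state -> Prop) (Q : state -> Prop) :
  (forall t st, I t st -> safe_test W st b /\
     if ev_test st b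
     then exists t1 t2, wp W P t1 (I t2) st /\ cost_test b + t1 + t2 <= t
     else cost_test b <= t /\ Q st) ->
  forall t st, I t st -> wp W (While b P) t Q st.
Proof.
move=> step t; have [n] := ubnP t; elim: n t => // n IH t tn st.
case/step=> /eval_testE; case: ifP => _ bE.
  case=> t1 [t2 [[tm [st1 [ex le inv]]] t_le]].
  (* A test costs at least one step, so each turn leaves strictly less time and the induction on [t]
     applies. *)
  have b0 := cost_test_gt0 b.
  have [|tm' [st2 [ex' le' q]]] := IH t2 _ st1 inv; first lia.
  exists (cost_test b + tm + tm'), st2; split=> //; last lia.
  exact: ExecWhileStep bE ex ex'.
by case=> le q; exists (cost_test b), st; split=> //; apply: ExecWhileEnd.
Qed.

(** Weakest precondition of a loop-free program. A loop gets [False], so it has to go through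
    [wp_while]. *)
Fixpoint vc W (P : cmd) (Q : state -> Prop) (st : state) : Prop :=
  match P with
  | Skip => Q st
  | SetReg x f => safe W st f /\ Q (set_reg st x (ev st f))
  | Put a f g => [/\ safe W st f, safe W st g & Q (set_arr st a (ev st f) (ev st g))]
  | Then P1 P2 => vc W P1 (vc W P2 Q) st
  | If b P1 P2 => safe_test W st b /\
      if ev_test st b then vc W P1 Q st else vc W P2 Q st
  | While _ _ => False
  end.

(** Adding the two branches of a conditional overestimates their maximum, which is harmless for
    constant bounds. *)
Fixpoint span (P : cmd) : nat :=
  match P with
  | Skip => 1
  | SetReg _ f => (cost f).+1
  | Put _ f g => (cost f + cost g).+1
  | Then P1 P2 => span P1 + span P2
  | If b P1 P2 => cost_test b + (span P1 + span P2)
  | While _ _ => 0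
  end.

Lemma vc_wp W P Q st : vc W P Q st -> wp W P (span P) Q st.
Proof.
elim: P Q st => [|x f|a f g|P1 IH1 P2 IH2|b P1 IH1 P2 IH2|//] Q st /=.
- by move=> q; exists 1, st; split=> //; apply: ExecSkip.
- by case=> /evalE[fE _] q; do 2!eexists; split; [apply: ExecSetReg fE | | ].
- case=> /evalE[fE _] /evalE[gE _] q.
  by do 2!eexists; split; [apply: ExecPut fE gE | | ].
- move=> /IH1 w; apply: wp_then; apply: wp_weaken w _ _ => // st'; exact: IH2.
- case=> /eval_testE bE w.
  have {w} : wp W (if ev_test st b then P1 else P2) (span P1 + span P2) Q st.
    by case: (ev_test st b) w => [/IH1|/IH2] w; apply: wp_weaken w _ _ => //; lia.
  case=> tm [st' [ex le q]]; exists (cost_test b + tm), st'.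
  by split=> //; [apply: ExecIf bE ex | lia].
Qed.

Lemma wp_vc W P t Q st : span P <= t -> vc W P Q st -> wp W P t Q st.
Proof. by move=> le /vc_wp w; apply: wp_weaken w le _. Qed.

(** * One end of the sweep *)

Lemma upd_same (T : Type) (f : nat -> T) x y : upd f x y x = y.
Proof. by rewrite /upd eqxx. Qed.

Lemma upd_other (T : Type) (f : nat -> T) x y z : z != x -> upd f x y z = f z.
Proof. by rewrite /upd => /negbTE->. Qed.

Section Sweep.

Variables (s k : nat) (L : nat -> seq nat).
Hypothesis L_sorted : forall u, sorted ltn (L u).
Hypothesis L_left : forall u (x : nat), x \in L u -> x < u.
Hypothesis L_mao : forall v x c, v < x <= s -> 0 < c <= size (L x) ->
  nth 0 (L x) c.-1 < v -> c <= size (L v).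

Local Notation nbr c x := (nth 0 (L x) c.-1).

Lemma nbr_mem c x : 0 < c <= size (L x) -> nbr c x \in L x.
Proof. move=> c_le; apply: mem_nth => /=; lia. Qed.

Lemma nbr_lt c x : 0 < c <= size (L x) -> nbr c x < x.
Proof. by move=> c_le; apply/L_left/nbr_mem. Qed.

Lemma nbr_mono c d x : 0 < c < d -> d <= size (L x) -> nbr c x < nbr d x.
Proof.
move=> cd d_le; apply: (sorted_ltn_nth ltn_trans 0 (L_sorted x)); rewrite ?inE; lia.
Qed.

Section Side.

Variables (A : seq nat) (h : nat).

(* [A] holds the start vertices of one end.  The hub [h] is the only vertex that
   several threads may come from: s for the source of a fan, 0 (none) otherwise.
   The vertices >= b have been processed; up u is the vertex from which the
   thread settled at u came, 0 if u is a start vertex or no thread settled at u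
   (0 is unambiguous: vertex 0 has no left neighbour), and [M] is the list of the
   vertices at which two threads met. *)
Definition settled b (up : nat -> nat) u := (b <= u) && ((u \in A) || (up u != 0)).

Definition free b up (M : seq nat) x := [&& x <= s, settled b up x & x \notin M].

Record links b up M : Prop := Links {
  links_up : forall u, up u != 0 ->
    [/\ b <= u, u < up u, u \in L (up u) & free b up M (up u)];
  links_inj : forall u v, up u = up v -> up u != 0 -> u = v \/ up u = h;
  links_meet : forall m, m \in M -> settled b up m }.

(* prd c is the vertex at which thread c last settled, 0 if there is none; the
   threads 1, ..., cnt have not started, and act holds of the colours in use. *)
Record side b cnt (prd up : nat -> nat) M (act : nat -> bool) : Prop := Side {
  side_links : links b up M;
  side_cnt : cnt = count (ltn^~ b) A;
  side_prd : forall c, 0 < c -> prd c != 0 ->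
    [/\ cnt < c <= k, free b up M (prd c), c <= size (L (prd c)) & nbr c (prd c) < b];
  side_inj : forall c d, 0 < c -> 0 < d -> prd c = prd d -> prd c != 0 ->
    c = d \/ prd c = h;
  side_prd_up : forall c u, 0 < c -> prd c = up u -> prd c != 0 -> prd c = h;
  side_act : forall c, 0 < c -> act c = (prd c != 0) || (c <= cnt) }.

(* The scan of v, before colour c.  Slot last of prd is vacant (its content is
   stale): it awaits the vertex of the next thread that points at v.  Initially
   it is slot 0, or the slot of the colour of the thread that starts at v; in the
   end, slot 0 holds the vertex from which the thread settled at v came. *)
Record mid v c last cnt (prd up : nat -> nat) M (act : nat -> bool) : Prop := Mid {
  mid_links : links v.+1 up M;
  mid_cnt : cnt = count (ltn^~ v) A;
  mid_last : last < c;
  mid_last_cnt : 0 < last -> cnt < last <= k;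
  mid_prd : forall d, 0 < d -> d != last -> prd d != 0 ->
    [/\ cnt < d <= k, free v.+1 up M (prd d), d <= size (L (prd d)),
        nbr d (prd d) <= v & d < c -> nbr d (prd d) < v];
  mid_stay : (0 < last) = (v \in A) || (prd 0 != 0);
  mid_zero : prd 0 != 0 -> free v.+1 up M (prd 0) /\ v \in L (prd 0);
  mid_inj : forall d d', d != last -> d' != last -> prd d = prd d' ->
    prd d != 0 -> d = d' \/ prd d = h;
  mid_prd_up : forall d u, d != last -> prd d = up u -> prd d != 0 -> prd d = h;
  mid_act : forall d, 0 < d -> act d = [|| d == last, prd d != 0 | d <= cnt] }.

Lemma free_bounds b up M x : free b up M x -> b <= x <= s.
Proof. by case/and3P=> ? /andP[? _] _; apply/andP. Qed.

Lemma count_ltS v : uniq A -> count (ltn^~ v.+1) A = (v \in A) + count (ltn^~ v) A.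
Proof.
move=> A_uniq; rewrite -count_uniq_mem // -count_predUI addnC.
rewrite (@eq_count _ (predI _ _) pred0) => [|x /=]; last by case: eqP => // ->; rewrite /= ltnn.
rewrite count_pred0 add0n; apply: eq_count => x /=.
by rewrite ltnS leq_eqVlt.
Qed.

(** A vertex that is free before [v] is processed is larger than [v], so neither the new link nor a
    new meeting at [v] touches it. *)
Lemma free_step v up M x y M' : free v.+1 up M x ->
  (forall m, m \in M' -> m \in M \/ m = v) -> free v (upd up v y) M' x.
Proof.
move=> fx M'P; have := free_bounds fx; move: fx; rewrite /free /settled /upd.
case: (x =P v) => [->|_ /and3P[-> /andP[_ ->] xM] xv /=]; first lia.
by apply/andP; split; [lia | apply/negP => /M'P[]; [apply/negP | lia]].
Qed.

(** The new link leaves [v], where there was none before, and ends at a vertex that no link enters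
    yet, unless it is the hub; so injectivity survives. *)
Lemma links_step v (up : nat -> nat) (M : seq nat) (x : nat) (M' : seq nat) : links v.+1 up M ->
  (x != 0 -> [/\ free v.+1 up M x, v \in L x & forall u, x = up u -> x = h]) ->
  (forall m, m \in M' -> m \in M \/ m = v /\ settled v (upd up v x) v) ->
  links v (upd up v x) M'.
Proof.
move=> [upP upI upM] xP M'P.
have M'P' m : m \in M' -> m \in M \/ m = v by move/M'P => [|[]]; auto.
have up_new u y : up u != 0 -> up u = y -> u <> v.
  by move=> nz _ uv; have [] := upP _ nz; lia.
split.
- move=> u; case: (u =P v) => [->|/eqP uv];
    last rewrite !(upd_other _ _ uv) => un0; first rewrite !upd_same => xn0.
    have [fx vx _] := xP xn0; split=> //; first by have := free_bounds fx; lia.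
    exact: free_step fx M'P'.
  by have [? ? ? fu] := upP _ un0; split=> //; [lia | apply: free_step fu M'P'].
- move=> u w; rewrite /upd; case: (u =P v) => [->|_]; case: (w =P v) => [->|_]; auto.
  + by move=> xw xn0; right; have [_ _ H] := xP xn0; apply: H xw.
  + move=> ux; rewrite ux => xn0; right; have [_ _ H] := xP xn0.
    by rewrite (H u).
- move=> m /M'P[/upM|[-> //]]; rewrite /settled /upd.
  by case: (m =P v) => [->|_]; lia.
Qed.

(** A thread starting at [v] takes the largest unstarted colour [cnt]. Colours up to [cnt] have no
    settled thread, so the scan may begin just above it. Otherwise slot 0 is vacant and the scan
    begins at colour 1. *)
Lemma mid_start v cnt prd up M act : uniq A -> size A <= k ->
  side v.+1 cnt prd up M act ->
  let last := if v \in A then cnt else 0 in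
  mid v last.+1 last (if v \in A then cnt.-1 else cnt) (upd prd 0 0) up M act.
Proof.
move=> A_uniq A_size [lk cntE prdP prdI prdU actP] last.
have A_k : count (ltn^~ v.+1) A <= k by rewrite (leq_trans (count_size _ _)).
have cntS := count_ltS v A_uniq.
have prd_last d : d <= cnt -> 0 < d -> prd d = 0.
  by move=> d_le d0; apply/eqP/negPn/negP => /(prdP _ d0)[]; lia.
split; rewrite /last ?/upd //=.
- by move: cntS; rewrite -cntE; case: (v \in A) => /=; lia.
- by case: (v \in A) cntS; lia.
- move=> d d0 _; rewrite (negbTE (lt0n_neq0 d0)) => nz.
  have [? ? ? ?] := prdP _ d0 nz; split=> //; try lia.
    by case: ifP; lia.
  by case: ifP; lia.
- by case: (v \in A) cntS; lia.
- by move=> [|d] [|d'] //= _ _ e nz; [rewrite e in nz | apply: prdI].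
- by move=> [|d] u //= _ e nz; apply: (prdU _ u).
- move=> [|d] //= _; rewrite actP //; case: (v \in A) cntS => vA; last by case: eqP => //; lia.
  by case: (prd d.+1 != 0); rewrite ?orbT //=; lia.
Qed.

Lemma mid_skip v c last cnt prd up M act :
  mid v c last cnt prd up M act -> ~~ ((prd c != 0) && (nbr c (prd c) == v)) ->
  mid v c.+1 last cnt prd up M act.
Proof.
move=> [lk cntE lc lcnt prdP st z prdI prdU actP] nhit; split=> //; first lia.
move=> d d0 dl nz; have [? ? ? ? lt] := prdP _ d0 dl nz; split=> // dc.
case: (ltnP d c) => [/lt //|cd]; have dE : d = c by lia.
by subst d; move: nhit; rewrite nz /=; lia.
Qed.

(** The vertex [x] of thread [c] is handed down to the vacant slot. If that slot is a positive
    colour, [x] now points lower, as left neighbours increase with the colour; if it is slot 0, this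
    is the thread that settles at [v]. Slot [c] becomes vacant. *)
Lemma mid_hit v c last cnt prd up M act :
  mid v c last cnt prd up M act -> prd c != 0 -> nbr c (prd c) = v ->
  mid v c.+1 c cnt (upd prd last (prd c)) up M act.
Proof.
move=> [lk cntE lc lcnt prdP st z prdI prdU actP] nz hit.
have c0 : 0 < c by lia.
have cl : c != last by lia.
have [ck fc cL _ _] := prdP _ c0 cl nz.
have vL : v \in L (prd c) by rewrite -hit nbr_mem ?c0.
split=> //; rewrite ?/upd.
- move=> d d0 dc; case: (d =P last) => [dl|/eqP dl] nz'; last first.
    have [? ? ? ? lt] := prdP _ d0 dl nz'; split=> // dc'; apply: lt; lia.
  have := lcnt; rewrite -dl => /(_ d0) ?.
  have : nbr d (prd c) < v by rewrite -hit; apply: nbr_mono; lia.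
  by split=> //; lia.
- case: (0 =P last) => [_|/eqP ?]; first by rewrite nz orbT c0.
  by rewrite -st; lia.
- by case: (0 =P last).
- move=> d d' dc d'c; case: (d =P last) => [->|/eqP dl]; case: (d' =P last) => [->|/eqP d'l]; auto.
  + by move=> e nz'; have [] := prdI _ _ cl d'l e nz' => // ?; lia.
  + by move=> e nz'; have [] := prdI _ _ dl cl e nz' => // ?; lia.
- by move=> d u dc; case: (d =P last) => [_|/eqP dl]; apply: prdU.
- move=> d d0; rewrite actP //; case: (d =P last) => [->|/eqP dl] /=.
    by rewrite nz orbT.
  case: (d =P c) => [->|//]; by rewrite nz.
Qed.

Definition scan_up v (prd up : nat -> nat) := upd up v (prd 0).

Lemma mid_step v c last cnt prd up M M' act :
  mid v c last cnt prd up M act ->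
  (forall m, m \in M' -> m \in M \/ 0 < last /\ m = v) ->
  links v (scan_up v prd up) M'.
Proof.
move=> [lk cntE lc lcnt prdP st z prdI prdU actP] M'P; apply: links_step lk _ _.
  move=> nz; have [? ?] := z nz; split=> // u e.
  by apply: (prdU 0 u) => //; move: st; rewrite nz orbT; lia.
move=> m /M'P[|[l0 ->]]; [by left | right; split=> //].
by rewrite /settled leqnn /upd eqxx -st.
Qed.

(** The scan has passed every active colour, so all other threads point below [v], and the thread at
    [v] goes on with colour [last]. If [last] is 0, only the dummy slot 0 is written. *)
Lemma finish_plain v c last cnt prd up M act :
  mid v c last cnt prd up M act -> v <= s -> v \notin M ->
  (forall d, act d -> d < c) -> last <= size (L v) ->
  side v cnt (upd prd last v) (scan_up v prd up) M act.
Proof.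
move=> md vs vM actc lL; have lks := mid_step (M' := M) md (fun m mM => or_introl mM).
case: md => [lk cntE lc lcnt prdP st z prdI prdU actP].
(* All vertices stored so far exceed [v], so storing [v] cannot break injectivity. *)
have big d : d != last -> prd d != 0 -> v < prd d.
  case: d => [_|d dl] nz.
    by have [/free_bounds] := z nz; lia.
  by have [// | _ /free_bounds] := prdP _ _ dl nz; lia.
have bigup u : up u != 0 -> v < up u.
  by move=> nz; have [] := links_up lk nz; lia.
split=> //; rewrite ?/scan_up ?/upd.
- move=> d d0; case: (d =P last) => [dl|/eqP dl] nz.
    have := lcnt; rewrite -dl => /(_ d0) dk; split=> //; last by apply: nbr_lt; lia.
      by rewrite /free /settled vs vM leqnn /upd eqxx -st -dl d0.
    by rewrite dl.
  have [? fd ? ? lt] := prdP _ d0 dl nz; split=> //.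
    by apply: free_step fd _ => m; left.
  by apply: lt; apply: actc; rewrite actP // nz orbT.
- move=> d d' d0 d'0; case: (d =P last) => [->|/eqP dl]; case: (d' =P last) => [->|/eqP d'l]; auto.
  + by move=> e nz; have := big _ d'l; rewrite -e; lia.
  + by move=> e nz; have := big _ dl nz; lia.
- move=> d u d0; case: (d =P last) => [dl|/eqP dl]; case: (u =P v) => [?|_].
  + by move=> e nz; have := big 0; rewrite -e; lia.
  + by move=> e nz; have := bigup u; rewrite -e; lia.
  + move=> e nz; have [||? //] := prdI d 0 dl _ e nz; last by lia.
    by have := st; rewrite -e nz orbT; lia.
  + exact: prdU.
- move=> d d0; rewrite actP //; case: (d =P last) => [dl|//] /=.
  (* As 0 encodes an empty slot, [v = 0] must be excluded: it would give
     [0 < last <= size (L 0) = 0]. *)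
  case: eqP => //= v0; subst; have : L 0 = [::].
    by case: (L 0) (@L_left 0) => // x l /(_ x); rewrite mem_head => /(_ isT).
  by move=> E; move: lL; rewrite E /=; lia.
Qed.

(** One update serves both ends: if [last] is the smaller colour, its slot receives the thread of
    colour [last']; otherwise slot [last] is itself retired. Either way slot [mx] ends up empty. *)
Lemma finish_meet v c last last' cnt prd up M act :
  mid v c last cnt prd up M act ->
  (forall d, act d -> d < c) -> 0 < last -> 0 < last' -> act last' ->
  let mx := maxn last last' in
  side v cnt (upd (upd prd last (prd last')) mx 0) (scan_up v prd up)
    (rcons M v) (fun d => act d && (d != mx)).
Proof.
move=> md actc l0 l'0 actl' mx.
have MP m : m \in rcons M v -> m \in M \/ 0 < last /\ m = v.
  by rewrite mem_rcons inE => /orP[/eqP->|]; auto.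
have MP' m : m \in rcons M v -> m \in M \/ m = v by move/MP => [|[]]; auto.
have lks := mid_step md MP.
case: md => [lk cntE lc lcnt prdP st z prdI prdU actP].
(* [last] exceeds [cnt], so an active colour above it has been started at this end. *)
have prd'l : last < last' -> prd last' != 0.
  by move: actl'; rewrite actP //; have := lcnt l0; lia.
have newE d : d != mx -> upd (upd prd last (prd last')) mx 0 d =
    prd (if d == last then last' else d).
  by rewrite /upd => /negbTE->; case: eqP.
have old d : 0 < d -> d != mx -> let d' := if d == last then last' else d in
  [/\ d' != last, 0 < d' & d <= d'].
  by rewrite /mx /= => dm; case: (d =P last) => dl; split; lia.
have newN d : upd (upd prd last (prd last')) mx 0 d != 0 -> d != mx.
  by apply: contraNneq => ->; rewrite /upd eqxx.
split=> //.
- move=> d d0 nz; have dm := newN _ nz; move: nz; rewrite newE //.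
  have [] := old d d0 dm; set d' := (if _ then _ else _) => d'l d'0 dd' nz.
  have [ck fd dL _ lt] := prdP _ d'0 d'l nz.
  have ltv : nbr d' (prd d') < v by apply: lt; apply: actc; rewrite actP // nz orbT.
  split.
  + have := lcnt l0; rewrite /d' in ck *; move: ck; case: eqP; lia.
  + exact: free_step fd MP'.
  + lia.
  (* A thread moved to a smaller colour points to a smaller left neighbour, hence still below
     [v]. *)
  + apply: leq_ltn_trans ltv; case: (ltngtP d d') => [lt'|?|<- //]; last lia.
    by apply/ltnW/nbr_mono; lia.
- move=> d e d0 e0 E nz; have dm := newN _ nz.
  have em : e != mx by apply: newN; rewrite -E.
  move: E nz; rewrite !newE //.
  have [dl _ _] := old d d0 dm; have [el _ _] := old e e0 em => E nz.
  have [|] := prdI _ _ dl el E nz; last by right.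
  rewrite /mx in dm em; left; move: a => {E nz dl el}; case: eqP; case: eqP; lia.
- move=> d u d0 E nz; have dm := newN _ nz; move: E nz; rewrite newE //.
  have [dl d'0 _] := old d d0 dm; rewrite /scan_up /upd; case: (u =P v) => _ E nz.
    have [||? //] := prdI _ 0 dl _ E nz; lia.
  exact: prdU E nz.
- move=> d d0; case: (d =P mx) => [->|/eqP dm].
    rewrite andbF /upd eqxx /=; have := lcnt l0; rewrite /mx; lia.
  rewrite newE // andbT actP //; case: (d =P last) => //= dl.
  have ll : last < last' by move: dm; rewrite /mx; lia.
  by rewrite prd'l.
Qed.

(** Here the ordering enters. A thread settled above [v] and pointing below [v] is bounded by
    [L_mao], one settled at [v] by the invariant, and an unstarted colour by the number of start
    vertices below [v]. *)
Lemma act_le v cnt prd up M act d : v <= s -> count (ltn^~ v) A <= size (L v) ->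
  side v cnt prd up M act -> 0 < d -> act d -> d <= size (L v).
Proof.
move=> vs A_count sd d0; rewrite (side_act sd) // => /orP[nz|].
  have [ck /free_bounds fd dL ltv] := side_prd sd d0 nz.
  have vx : v <= prd d by lia.
  move: vx; rewrite leq_eqVlt => /orP[/eqP -> //|vx].
  by apply: L_mao ltv; lia.
by rewrite (side_cnt sd) => H; apply: leq_trans H A_count.
Qed.

End Side.
End Sweep.

(** * Paths traced by the threads *)

Lemma uniq_flatten_map (T U : eqType) (f : T -> seq U) r :
  uniq r -> (forall x, x \in r -> uniq (f x)) ->
  (forall x y z, x \in r -> y \in r -> z \in f x -> z \in f y -> x = y) ->
  uniq (flatten (map f r)).
Proof.
elim: r => //= x r IH /andP[xr ur] fu fd; rewrite cat_uniq fu ?mem_head //=.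
apply/andP; split; last first.
  apply: IH => // [y yr|y y' z yr y'r]; first by rewrite fu // inE yr orbT.
  by apply: fd; rewrite inE ?yr ?y'r orbT.
apply/hasPn => z /flatten_mapP[y yr zy]; apply/negP => zx.
have xy := fd x y z; move: xr; rewrite xy ?yr ?mem_head //.
by rewrite inE yr orbT.
Qed.

Section Climb.

Variables (s : nat) (L : nat -> seq nat).

(** The number of links followed from [x], cut off by the fuel. Links increase and stay at most [s],
    so the fuel [s.+1] in [height] never runs out. *)
Fixpoint climb (up : nat -> nat) fuel x :=
  if fuel is f.+1 then if up x == 0 then 0 else (climb up f (up x)).+1 else 0.

Definition height up x := climb up s.+1 x.

Definition chain up x := traject up x (height up x).+1.

Definition rising (up : nat -> nat) := forall x, up x != 0 -> x < up x <= s.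

Lemma climbP up f x  : rising up -> x <= s -> s - x < f ->
  up (iter (climb up f x) up x) = 0 /\
  (forall i, i < climb up f x -> up (iter i up x) != 0).
Proof.
move=> ru; elim: f x => [|f IH] x xs; first by lia.
move=> sf /=; case: eqP => [//|/eqP nz].
have ub := ru _ nz.
have [||e H] := IH (up x); try lia.
split; first by rewrite -iterSr in e *.
by move=> [|i] //= ic; rewrite -iterS iterSr; apply: H.
Qed.

Lemma height_top up x : rising up -> x <= s -> up (iter (height up x) up x) = 0.
Proof. by move=> ru xs; have [|e _] := @climbP up s.+1 x ru xs; first lia. Qed.

Lemma height_nz up x i : rising up -> x <= s -> i < height up x -> up (iter i up x) != 0.
Proof. by move=> ru xs; have [|_ H] := @climbP up s.+1 x ru xs; [lia | apply: H]. Qed.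

Lemma iter_le up x i : rising up -> x <= s -> i <= height up x -> iter i up x <= s.
Proof.
by move=> ru xs; elim: i => //= i IH ih; have /ru := height_nz ru xs ih; lia.
Qed.

Lemma iter_nz up x i : rising up -> x <= s -> i <= height up x ->
  (up (iter i up x) != 0) = (i < height up x).
Proof.
move=> ru xs; rewrite leq_eqVlt => /orP[/eqP->|ih]; last by rewrite ih height_nz.
by rewrite height_top // ltnn eqxx.
Qed.

Section Side.

Variables (A : seq nat) (h : nat) (b : nat) (up : nat -> nat) (M : seq nat).
Hypothesis h_top : h = 0 \/ h = s.
Hypothesis lk : links s L A h b up M.
Hypothesis M_le : forall m, m \in M -> m <= s.

Lemma up_rising : rising up.
Proof. by move=> u nz; have [_ ? _ /free_bounds] := links_up lk nz; lia. Qed.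

Lemma chainE x : chain up x = x :: behead (chain up x).
Proof. by []. Qed.

Lemma mem_chain x z : z \in chain up x ->
  exists2 i, i <= height up x & z = iter i up x.
Proof. by case/trajectP => i ih ->; exists i. Qed.

(** Links end in free vertices, so a chain meets [M] only in its bottom. *)
Lemma chain_settled m z : m \in M -> z \in chain up m ->
  [/\ settled A b up z, z <= s & z = m \/ z \notin M].
Proof.
move=> mM /mem_chain[[|i] ih ->{z}].
  by split; [apply: (links_meet lk) | apply: M_le | left].
have nz := height_nz up_rising (M_le mM) ih.
by have [_ _ _ /and3P[]] := links_up lk nz; split=> //; right.
Qed.

Lemma chain_rel (R : rel nat) m : m \in M -> (forall u, up u != 0 -> R u (up u)) ->
  path R m (behead (chain up m)).
Proof.
move=> mM RP; apply/(pathP m) => i; rewrite size_behead size_traject /= => ih.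
rewrite -trajectS nth_traject; last lia.
rewrite (set_nth_default (up m)) ?size_traject // nth_traject // -iterSr.
exact/RP/height_nz/ih/M_le/mM/up_rising.
Qed.

Lemma chain_uniq m : m \in M -> uniq (chain up m).
Proof.
by move=> mM; apply: (sorted_uniq ltn_trans ltnn); apply: chain_rel => // u /up_rising/andP[].
Qed.

Lemma chain_last m : m \in M -> last m (behead (chain up m)) \in A.
Proof.
move=> mM; have ms := M_le mM.
have -> : last m (behead (chain up m)) = iter (height up m) up m.
  by rewrite /chain /= last_traject.
have [] := @chain_settled m (iter (height up m) up m) mM.
  by apply/trajectP; exists (height up m).
by rewrite /settled (height_top up_rising) // eqxx orbF => /andP[].
Qed.

(** A common vertex is traced back down both chains: injectivity of links makes the predecessors
    agree until a bottom is reached, and only bottoms lie in [M]. The condition [z != 0] voids the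
    exception when there is no hub. *)
Lemma chain_disjoint m m' z : m \in M -> m' \in M ->
  z \in chain up m -> z \in chain up m' -> m = m' \/ z = h /\ z != 0.
Proof.
move=> mM m'M /mem_chain[i ih ->{z}] zm'.
elim: i ih zm' => [|i IH] ih zm' /=.
  by have [_ _ []] := chain_settled m'M zm'; [left | rewrite mM].
have nz := height_nz up_rising (M_le mM) ih.
have [_ _ zM] : [/\ True, True & up (iter i up m) \notin M].
  by have [_ _ _ /and3P[]] := links_up lk nz.
case/mem_chain: zm' => [[|j] jh /= E].
  by move: zM; rewrite E m'M.
have [e|] := links_inj lk E nz; last by right.
have [||m_m'|[e' nz']] := IH; first lia.
- by rewrite e; apply/trajectP; exists j => //; lia.
- by left.
(* The predecessor is not the hub: it is nonzero, and from [s] no link can rise. *)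
have := up_rising nz; case: h_top => hE; rewrite -?e'; last by rewrite e' hE; lia.
by move: nz'; rewrite e' hE.
Qed.

(** Without their last vertices, the only possible place of the hub, the chains are disjoint, and
    they lie between [b] and [s]. This bounds the length of the output. *)
Lemma sum_height : uniq M ->
  \sum_(m <- M) height up m <= s.+1 - b.
Proof.
move=> uM; set f := fun m => traject up m (height up m).
have fP m z : m \in M -> z \in f m -> z \in chain up m /\ up z != 0.
  move=> mM /trajectP[i ih ->]; split; last exact: height_nz up_rising (M_le mM) ih.
  by apply/trajectP; exists i => //; lia.
have -> : \sum_(m <- M) height up m = size (flatten (map f M)).
  rewrite size_flatten /shape -map_comp sumnE big_map.
  by apply: eq_bigr => m _; rewrite /= size_traject.
have -> : s.+1 - b = size (iota b (s.+1 - b)) by rewrite size_iota.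
apply: uniq_leq_size.
  apply: uniq_flatten_map => // [m mM|m m' z mM m'M zm zm'].
    have := chain_uniq mM; rewrite /chain trajectSr rcons_uniq; by case/andP.
  have [zc nz] := fP _ _ mM zm; have [zc' _] := fP _ _ m'M zm'.
  have [//|[zh z0]] := chain_disjoint mM m'M zc zc'.
  have := up_rising nz; case: h_top => hE; move: z0; rewrite zh hE //; lia.
move=> z /flatten_mapP[m mM zm]; have [zc nz] := fP _ _ mM zm.
have [] := chain_settled mM zc; rewrite mem_iota /settled; case/andP; lia.
Qed.

End Side.

(** * Joining the two halves of a path at its meeting vertex *)

Section Join.

Variables (A A' : seq nat) (h b : nat) (up up' : nat -> nat) (M : seq nat).

Definition joined m := rev (chain up m) ++ behead (chain up' m).

Lemma size_joined m : size (joined m) = (height up m + height up' m).+1.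
Proof. by rewrite size_cat size_rev size_behead !size_traject. Qed.

Lemma nth_joined m q : q < (height up m + height up' m).+1 ->
  nth 0 (joined m) q =
    if q <= height up m then iter (height up m - q) up m
    else iter (q - height up m) up' m.
Proof.
move=> qlt; rewrite nth_cat size_rev size_traject ltnS; case: leqP => qh.
  rewrite nth_rev ?size_traject // subSS (set_nth_default m) ?size_traject; last lia.
  by rewrite nth_traject //; lia.
rewrite nth_behead subnSK // (set_nth_default m) ?size_traject; last lia.
by rewrite nth_traject //; lia.
Qed.

Hypothesis h_top : h = 0 \/ h = s.
Hypothesis lk : links s L A h b up M.
Hypothesis lk' : links s L A' 0 b up' M.
Hypothesis M_le : forall m, m \in M -> m <= s.
Hypothesis both : forall u, settled A b up u -> settled A' b up' u -> u \in M.

Definition adj x y := (x \in L y) || (y \in L x).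

Lemma joinedE m : joined m = last m (behead (chain up m)) ::
  rev (belast m (behead (chain up m))) ++ behead (chain up' m).
Proof. by rewrite /joined {1}chainE [m :: _]lastI rev_rcons. Qed.

Lemma mem_joined m z : z \in joined m -> z \in chain up m \/ z \in chain up' m.
Proof.
rewrite mem_cat mem_rev => /orP[|H]; [by left | right].
by rewrite chainE inE H orbT.
Qed.

Let h0_top : 0 = 0 \/ 0 = s. Proof. by left. Qed.

(** A common vertex of chains of opposite ends is settled at both ends, hence in [M], hence the
    bottom of either chain. *)
Let cross m m' z : m \in M -> m' \in M -> z \in chain up m -> z \in chain up' m' ->
  m = z /\ m' = z.
Proof.
move=> mM m'M zc zc'.
have [sz _ e] := chain_settled h_top lk M_le mM zc.
have [sz' _ e'] := chain_settled h0_top lk' M_le m'M zc'.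
have zM := both sz sz'.
by split; [case: e | case: e'] => //; rewrite zM.
Qed.

Lemma joined_uniq m : m \in M -> uniq (joined m).
Proof.
move=> mM; rewrite cat_uniq rev_uniq (chain_uniq h_top lk) //.
have := chain_uniq h0_top lk' M_le mM; rewrite {1}chainE /= => /andP[mc ->].
rewrite andbT; apply/hasPn => z zc'; rewrite /= mem_rev; apply/negP => zc.
have [e _] : m = z /\ m = z by apply: cross; rewrite // chainE inE zc' orbT.
by move: mc; rewrite [X in X \notin _]e zc'.
Qed.

Lemma joined_path m : m \in M ->
  path adj (last m (behead (chain up m))) (behead (joined m)).
Proof.
move=> mM; rewrite joinedE /= cat_path.
have adjS : symmetric adj by move=> x y; rewrite /adj orbC.
have adjL x y : x \in L y -> adj x y by rewrite /adj => ->.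
apply/andP; split.
  rewrite rev_path (eq_path (e' := adj)) => [|x y]; last exact: adjS.
  by apply: (chain_rel h_top lk) => // u /(links_up lk)[_ _ ? _]; apply: adjL.
have -> : last (last m (behead (chain up m))) (rev (belast m (behead (chain up m)))) = m.
  by case: (behead _) => //= x c; rewrite rev_cons last_rcons.
by apply: (chain_rel h0_top lk') => // u /(links_up lk')[_ _ ? _]; apply: adjL.
Qed.

Lemma joined_first m : m \in M -> last m (behead (chain up m)) \in A.
Proof. exact: (chain_last h_top lk). Qed.

Lemma joined_last m : m \in M ->
  last (last m (behead (chain up m))) (behead (joined m)) \in A'.
Proof.
move=> mM; rewrite joinedE /= last_cat.
have -> : last (last m (behead (chain up m))) (rev (belast m (behead (chain up m)))) = m.
  by case: (behead _) => //= x c; rewrite rev_cons last_rcons.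
exact: (chain_last h0_top lk').
Qed.

Lemma joined_disjoint m m' z : m \in M -> m' \in M ->
  z \in joined m -> z \in joined m' -> m = m' \/ z = h /\ z != 0.
Proof.
move=> mM m'M /mem_joined[zc|zc] /mem_joined[zc'|zc'].
- exact: (chain_disjoint h_top lk) zc zc'.
- by have [-> ->] := cross mM m'M zc zc'; left.
- by have [-> ->] := cross m'M mM zc' zc; left.
- by have [?|[->]] := chain_disjoint h0_top lk' M_le mM m'M zc zc'; [left|].
Qed.

Lemma joined_le m z : m \in M -> z \in joined m -> z <= s.
Proof.
move=> mM /mem_joined[] zc.
  by have [] := chain_settled h_top lk M_le mM zc.
by have [] := chain_settled h0_top lk' M_le mM zc.
Qed.

End Join.
End Climb.

(** * The sweep *)

(* Ends are booleans: false is the source, true the target.  Register 3 holds the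
   vertex being processed, 4 the number of colours to be scanned, 9 the colour (or
   path) index, 11 the number of meeting vertices, which fill array 12. *)
Definition r_cnt (sd : bool) := if sd then 6 else 5.
Definition r_last (sd : bool) := if sd then 8 else 7.
Definition a_prd (sd : bool) := if sd then 7 else 6.
Definition a_up (sd : bool) := if sd then 9 else 8.
Definition a_mark (sd : bool) := if sd then 11 else 10.

Definition scan_init sd :=
  Then
    (If (Eq (Get (a_mark sd) (Reg 3)) (Const 0))
       (SetReg (r_last sd) (Const 0))
       (Then (SetReg (r_last sd) (Reg (r_cnt sd)))
          (SetReg (r_cnt sd) (Defs.Sub (Reg (r_cnt sd)) (Const 1)))))
    (Then (Put (a_prd sd) (Const 0) (Const 0))
       (SetReg 9 (Add (Reg (r_last sd)) (Const 1)))).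

(** The lists of left neighbours are stored consecutively, so the one of colour [c] of [x] is in
    cell [off x + c - 1]. *)
Definition scan_body sd :=
  Then (SetReg 10 (Get (a_prd sd) (Reg 9)))
    (Then
       (If (Eq (Reg 10) (Const 0)) Skip
          (If (Eq (Get 1 (Defs.Sub (Add (Get 0 (Reg 10)) (Reg 9)) (Const 1))) (Reg 3))
             (Then (Put (a_prd sd) (Reg (r_last sd)) (Reg 10))
                (SetReg (r_last sd) (Reg 9)))
             Skip))
       (SetReg 9 (Add (Reg 9) (Const 1)))).

Definition scan sd :=
  Then (scan_init sd)
    (Then (While (Not (Lt (Reg 4) (Reg 9))) (scan_body sd))
       (Put (a_up sd) (Reg 3) (Get (a_prd sd) (Const 0)))).

(** An end that has not settled at [v] has colour 0, so its write goes to slot 0, which the next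
    scan resets. *)
Definition plain := Then (Put 6 (Reg 7) (Reg 3)) (Put 7 (Reg 8) (Reg 3)).

(* With truncated subtraction, Reg 7 + (Reg 8 - Reg 7) is the larger colour. *)
Definition meet :=
  Then (Put 12 (Reg 11) (Reg 3))
  (Then (SetReg 11 (Add (Reg 11) (Const 1)))
  (Then (Put 6 (Reg 7) (Get 6 (Reg 8)))
  (Then (Put 7 (Reg 8) (Get 7 (Reg 7)))
  (Then (SetReg 10 (Add (Reg 7) (Defs.Sub (Reg 8) (Reg 7))))
  (Then (Put 6 (Reg 10) (Const 0)) (Put 7 (Reg 10) (Const 0))))))).

Definition combine :=
  If (Eq (Reg 7) (Const 0)) plain (If (Eq (Reg 8) (Const 0)) plain meet).

Definition lower_hi :=
  Then (SetReg 10 (Defs.Sub (Get 0 (Add (Reg 3) (Const 1))) (Get 0 (Reg 3))))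
    (If (Lt (Reg 10) (Reg 4)) (SetReg 4 (Reg 10)) Skip).

Definition step :=
  Then (Then (SetReg 3 (Defs.Sub (Reg 3) (Const 1))) (Then (scan false) (scan true)))
    (Then combine lower_hi).

Definition sweep := While (Lt (Reg 11) (Reg 1)) step.

Definition same (rs arrs : seq nat) (st st' : state) :=
  (forall r, r \notin rs -> reg st' r = reg st r) /\
  (forall a, a \notin arrs -> arr st' a = arr st a).

Ltac same_tac :=
  match goal with |- same _ _ _ _ => split | _ => idtac end;
  intro; rewrite ?inE /= /upd; do ?[case: eqP => [->|_] //=]; by [].

Lemma same_trans rs arrs st st1 st2 rs' arrs' :
  same rs arrs st st1 -> same rs' arrs' st1 st2 ->
  all (mem rs) rs' && all (mem arrs) arrs' -> same rs arrs st st2.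
Proof.
move=> [sr sa] [sr' sa'] /andP[/allP rsP /allP arrsP].
split=> z zn; rewrite ?sr' ?sa' ?sr ?sa //.
  by apply: contra zn; apply: rsP.
by apply: contra zn; apply: arrsP.
Qed.

Lemma same_sub rs arrs st st1 rs' arrs' : same rs arrs st st1 ->
  all (mem rs') rs && all (mem arrs') arrs -> same rs' arrs' st st1.
Proof. by move=> sm; apply: same_trans sm; split. Qed.

(** * Correctness and running time of the sweep *)

Section Program.

Variables (W s k m : nat) (L : nat -> seq nat) (off nb : nat -> nat).
Hypothesis L_sorted : forall u, sorted ltn (L u).
Hypothesis L_left : forall u (x : nat), x \in L u -> x < u.
Hypothesis L_mao : forall v x c, v < x <= s -> 0 < c <= size (L x) ->
  nth 0 (L x) c.-1 < v -> c <= size (L v).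
Hypothesis off_le : forall x, x <= s -> off x <= off x.+1 <= m.
Hypothesis off_size : forall x, x <= s -> off x.+1 - off x = size (L x).
Hypothesis nb_nth : forall x c, x <= s -> 0 < c <= size (L x) ->
  nb (off x + c - 1) = nth 0 (L x) c.-1.
Hypothesis W_big : 3 * (s + k) + m + 20 < W.

Variables (A : bool -> seq nat) (h : bool -> nat).
Hypothesis A_uniq : forall sd, uniq (A sd).
Hypothesis A_size : forall sd, size (A sd) <= k.
Hypothesis A_count : forall sd v, v <= s -> count (ltn^~ v) (A sd) <= size (L v).

Definition graph st := [/\ reg st 1 = k, reg st 2 = s, arr st 0 = off & arr st 1 = nb].

Lemma scan_body_wp sd v c last cnt M act st : v <= s ->
  graph st -> reg st 3 = v -> reg st 9 = c -> c <= k -> reg st (r_last sd) = last ->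
  (forall d, arr st (a_prd sd) d <= s) ->
  mid s k L (A sd) (h sd) v c last cnt (arr st (a_prd sd)) (arr st (a_up sd)) M act ->
  wp W (scan_body sd) 40 (fun st' =>
    [/\ same [:: 9; 10; r_last sd] [:: a_prd sd] st st', reg st' 9 = c.+1,
        forall d, arr st' (a_prd sd) d <= s &
        mid s k L (A sd) (h sd) v c.+1 (reg st' (r_last sd)) cnt
          (arr st' (a_prd sd)) (arr st (a_up sd)) M act]) st.
Proof.
move=> vs [r1 r2 a0 a1] r3 r9 ck rl ps md.
have := mid_last md => lc.
have c0 : 0 < c by lia.
have cl : c != last by lia.
have pc := ps c.
have prdP := mid_prd md c0 cl.
have skip := mid_skip md; have hit := mid_hit L_sorted md.
apply: wp_vc; first by case: (sd).
case: sd rl ps {md} pc skip hit prdP => /= rl ps pc skip hit prdP;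
  rewrite /upd /= r9 r3 rl a0 a1;
  set x := arr st _ c in pc skip hit prdP *;
  (split; [by split; lia | split; [by split; lia |]]);
  (case: (x =P 0) => [x0|/eqP x0];
    [by split; [by split; lia | split=> //; [same_tac | lia | by apply: skip; rewrite x0]] |]);
  have [ck' /free_bounds xs cx _ _] := prdP x0;
  have [x_le off_x] := (off_le (x := x), off_size (x := x));
  (rewrite nb_nth; [| lia | lia]);
  (have nbW : nth 0 (L x) c.-1 < W by have := @nbr_lt L L_left c x; lia);
  (split; [by do !split=> //; lia |]);
  (case: (nth 0 (L x) c.-1 =P v) => [e|/eqP e];
    last by split; [by split; lia | split=> //;
      [same_tac | lia | by apply: skip; rewrite (negbTE e) andbF]]);
  (split; [lia | lia | split; [lia | split; [by split; lia | split]]]).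
all: try by [same_tac | lia | move=> d; case: ifP | apply: hit].
Qed.

Lemma scan_loop_wp sd v hi last cnt M act st : v <= s ->
  graph st -> reg st 3 = v -> reg st 4 = hi -> hi <= k ->
  reg st (r_last sd) = last -> reg st 9 = last.+1 ->
  (forall d, arr st (a_prd sd) d <= s) ->
  mid s k L (A sd) (h sd) v last.+1 last cnt (arr st (a_prd sd)) (arr st (a_up sd)) M act ->
  wp W (While (Not (Lt (Reg 4) (Reg 9))) (scan_body sd)) (4 + 44 * hi) (fun st' =>
    [/\ same [:: 9; 10; r_last sd] [:: a_prd sd] st st',
        forall d, arr st' (a_prd sd) d <= s &
        exists2 c, hi < c & mid s k L (A sd) (h sd) v c (reg st' (r_last sd)) cnt
          (arr st' (a_prd sd)) (arr st (a_up sd)) M act]) st.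
Proof.
move=> vs gr r3 r4 hik rl r9 ps md.
pose I t st' := [/\ same [:: 9; 10; r_last sd] [:: a_prd sd] st st',
  forall d, arr st' (a_prd sd) d <= s,
  mid s k L (A sd) (h sd) v (reg st' 9) (reg st' (r_last sd)) cnt
          (arr st' (a_prd sd)) (arr st (a_up sd)) M act &
  4 + 44 * (hi.+1 - reg st' 9) <= t /\ reg st' 9 <= k.+1].
apply: (wp_while (I := I)); last first.
  split=> //; [by rewrite r9 rl | rewrite r9; have := mid_last_cnt md; lia].
move=> {}t st1 [[sr sa] ps1 md1 [tm ck]] /=.
have r4' : reg st1 4 = hi by rewrite sr //; case: (sd).
rewrite r4'; split; first by lia.
case: ltnP => /= c_hi.
  by split; [lia | split=> //; exists (reg st1 9)].
(* The test costs 4 and the body at most 40 steps. *)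
exists 40, (4 + 44 * (hi.+1 - (reg st1 9).+1)); split; last by lia.
have gr1 : graph st1.
  by case: gr => r1 r2 a0 a1; split; rewrite ?sr ?sa //; case: (sd).
have r3' : reg st1 3 = v by rewrite sr //; case: (sd).
have up1 : arr st1 (a_up sd) = arr st (a_up sd) by rewrite sa //; case: (sd).
rewrite -up1 in md1.
have w := scan_body_wp vs gr1 r3' (erefl _) (leq_trans c_hi hik) (erefl _) ps1 md1.
apply: wp_weaken w (leqnn _) _ => st2 [sm r9'' ps2 md2]; split=> //.
- by apply: same_trans (conj sr sa) sm _; rewrite /= !inE !eqxx !orbT.
- by rewrite r9'' -up1.
- by rewrite r9''; lia.
Qed.

Lemma scan_wp sd v hi cnt M act st : v <= s ->
  graph st -> reg st 3 = v -> reg st 4 = hi -> hi <= k -> reg st (r_cnt sd) = cnt ->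
  arr st (a_mark sd) v = (v \in A sd) ->
  (forall d, arr st (a_prd sd) d <= s) ->
  side s k L (A sd) (h sd) v.+1 cnt (arr st (a_prd sd)) (arr st (a_up sd)) M act ->
  wp W (scan sd) (60 + 44 * hi) (fun st' =>
    [/\ same [:: 9; 10; r_last sd; r_cnt sd] [:: a_prd sd; a_up sd] st st',
        forall d, arr st' (a_prd sd) d <= s,
        arr st' (a_up sd) = scan_up v (arr st' (a_prd sd)) (arr st (a_up sd)) &
        exists2 c, hi < c & mid s k L (A sd) (h sd) v c (reg st' (r_last sd))
          (reg st' (r_cnt sd)) (arr st' (a_prd sd)) (arr st (a_up sd)) M act]) st.
Proof.
move=> vs gr r3 r4 hik rc mk ps sd0.
have md := mid_start (A_uniq sd) (A_size sd) sd0.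
have cntk : cnt <= k.
  by rewrite (side_cnt sd0) (leq_trans (count_size _ _)).
apply: wp_weaken (_ : wp W (scan sd) (30 + (4 + 44 * hi + 10)) _ st) _ (fun _ H => H); last lia.
pose last := if v \in A sd then cnt else 0.
apply: wp_then; apply: (wp_weaken (t := 30) (Q := fun st1 =>
  [/\ same [:: 9; 10; r_last sd; r_cnt sd] [:: a_prd sd] st st1,
      reg st1 (r_last sd) = last, reg st1 9 = last.+1,
      reg st1 (r_cnt sd) = (if v \in A sd then cnt.-1 else cnt) &
      arr st1 (a_prd sd) = upd (arr st (a_prd sd)) 0 0])) => // [|st1 [sm rl r9 rc1 pr]].
  apply: wp_vc; first by case: (sd).
  rewrite /last; move: (A_size sd) mk rc {ps md sd0 last}; case: sd => /= sz mk rc;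
    rewrite /upd /= r3 mk rc; case: (v \in _) => /=;
    (do ?[split; try lia]); try by same_tac.
have [sr sa] := sm.
have up1 : arr st1 (a_up sd) = arr st (a_up sd) by rewrite sa //; case: (sd).
have gr1 : graph st1.
  by case: gr => r1 r2 a0 a1; split; rewrite ?sr ?sa //; case: (sd).
have r3' : reg st1 3 = v by rewrite sr //; case: (sd).
have r4' : reg st1 4 = hi by rewrite sr //; case: (sd).
have ps1 d : arr st1 (a_prd sd) d <= s by rewrite pr /upd; case: ifP.
rewrite -pr -up1 -/last in md.
apply: wp_then; apply: wp_weaken (scan_loop_wp vs gr1 r3' r4' hik rl r9 ps1 md) (leqnn _) _.
move=> st2 [sm2 ps2 [c hic md2]]; have [sr2 sa2] := sm2.
have r3'' : reg st2 3 = v by rewrite sr2 //; case: (sd).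
have up2 : arr st2 (a_up sd) = arr st (a_up sd) by rewrite sa2 //; case: (sd).
have cnt2 : reg st2 (r_cnt sd) = reg st1 (r_cnt sd) by rewrite sr2 //; case: (sd).
have sm12 : same [:: 9; 10; r_last sd; r_cnt sd] [:: a_prd sd] st st2.
  by apply: same_trans sm sm2 _; rewrite /= !inE !eqxx !orbT.
have sm3 : same [::] [:: a_up sd] st2
    (set_arr st2 (a_up sd) v (arr st2 (a_prd sd) 0)).
  by case: (sd); same_tac.
have p0 := ps2 0.
apply: wp_vc => //=; rewrite r3''; split; [lia | by split; lia |].
split.
- have sm12' := same_sub (rs' := [:: 9; 10; r_last sd; r_cnt sd])
    (arrs' := [:: a_prd sd; a_up sd]) sm12.
  by apply: same_trans (sm12' _) sm3 _; rewrite /= ?inE ?eqxx ?orbT.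
- by move=> d; move: (ps2 d); case: (sd).
- by rewrite -up2 /scan_up; case: (sd).
- exists c => //; move: md2; rewrite up1 -rc1 -cnt2.
  by case: (sd).
Qed.

Definition meets st := mkseq (arr st 12) (reg st 11).

(** By [inv_count] each meeting has retired exactly one colour; by [inv_act] the next scan covers
    all colours in use; by [inv_both] paths of opposite ends touch only at meetings. *)
Record sweep_inv b act st : Prop := SweepInv {
  inv_graph : graph st;
  inv_b : reg st 3 = b;
  inv_bs : b <= s.+1;
  inv_hi : reg st 4 <= k;
  inv_mark : forall sd u, u < b -> arr st (a_mark sd) u = (u \in A sd);
  inv_prd : forall sd d, arr st (a_prd sd) d <= s;
  inv_side : forall sd, side s k L (A sd) (h sd) b (reg st (r_cnt sd))
    (arr st (a_prd sd)) (arr st (a_up sd)) (meets st) act;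
  inv_both : forall u, settled (A false) b (arr st (a_up false)) u ->
    settled (A true) b (arr st (a_up true)) u -> u \in meets st;
  inv_meets : uniq (meets st) /\ (forall x, x \in meets st -> x <= s);
  inv_count : count act (iota 1 k) + reg st 11 = k;
  inv_act : forall c, act c -> 0 < c <= reg st 4 }.

Lemma mid_notin v sd c last cnt prd up M act :
  mid s k L (A sd) (h sd) v c last cnt prd up M act -> v \notin M.
Proof.
by move=> md; apply/negP => /(links_meet (mid_links md)); rewrite /settled ltnn.
Qed.

Lemma mid_settled v sd c last cnt prd up M act u :
  mid s k L (A sd) (h sd) v c last cnt prd up M act ->
  settled (A sd) v (scan_up v prd up) u ->
  settled (A sd) v.+1 up u \/ u = v /\ 0 < last.
Proof.
move=> md; rewrite (mid_stay md) /settled /scan_up /upd.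
by case: (u =P v) => [->|/eqP uv] /andP[vu H]; [right | left; apply/andP; split=> //; lia].
Qed.

(** The end with [last = 0] can be closed on its own by [finish_plain]. The colour [last'] is active
    there as well, so [act_le] bounds it. *)
Lemma mid_last_le v sd sd' c c' last last' cnt cnt' prd prd' up up' M
    (act : nat -> bool) : v <= s ->
  (forall d, act d -> d < c) ->
  mid s k L (A sd) (h sd) v c last cnt prd up M act ->
  mid s k L (A sd') (h sd') v c' last' cnt' prd' up' M act ->
  last = 0 -> last' <= size (L v).
Proof.
move=> vs actc md md' l0; case: (posnP last') => [->//|l'0].
have l_le : last <= size (L v) by rewrite l0.
have sd0 := finish_plain L_left md vs (mid_notin md) actc l_le.
apply: (act_le L_mao vs (A_count sd vs) sd0 l'0).
by rewrite (mid_act md') ?eqxx.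
Qed.

Lemma count_drop (act : ssrbool.pred nat) x r : uniq r -> x \in r -> act x ->
  (count (fun d => act d && (d != x)) r).+1 = count act r.
Proof.
move=> ur xr ax; have := count_rem x act r; rewrite xr ax => e.
rewrite rem_filter // count_filter in e.
rewrite (eq_count (a2 := predI act (predC1 x))) // e subn1 prednK // -has_count.
by apply/hasP; exists x.
Qed.

Record scanned v act st st' : Prop := Scanned {
  scanned_same : same [:: 3; 9; 10; 7; 5; 8; 6] [:: 6; 8; 7; 9] st st';
  scanned_v : reg st' 3 = v;
  scanned_prd : forall sd d, arr st' (a_prd sd) d <= s;
  scanned_up : forall sd, arr st' (a_up sd) =
    scan_up v (arr st' (a_prd sd)) (arr st (a_up sd));
  scanned_mid : forall sd, exists2 c, reg st 4 < c &
    mid s k L (A sd) (h sd) v c (reg st' (r_last sd)) (reg st' (r_cnt sd))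
      (arr st' (a_prd sd)) (arr st (a_up sd)) (meets st) act }.

Lemma scan_both v act st : sweep_inv v.+1 act st ->
  wp W (Then (SetReg 3 (Defs.Sub (Reg 3) (Const 1))) (Then (scan false) (scan true)))
    (130 + 88 * reg st 4) (scanned v act st) st.
Proof.
case=> gr r3 vs hik mk ps sds _ _ _ _; rewrite ltnS in vs.
apply: (@wp_weaken _ _ (10 + ((60 + 44 * reg st 4) + (60 + 44 * reg st 4)))) (fun _ H => H);
  last lia.
apply: wp_then; apply: wp_vc => //=; rewrite /= r3; split; first by split; lia.
rewrite subn1 /=; set st1 := set_reg st 3 v.
apply: wp_then.
have [r1 r2 a0 a1] := gr.
have gr1 : graph st1 by split.
have w := @scan_wp false v (reg st 4) _ _ _ st1 vs gr1 erefl erefl hik erefl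
  (mk false v (leqnn _)) (ps false) (sds false).
apply: wp_weaken w (leqnn _) _ => st2 [sm2 ps2 up2 [c2 hc2 md2]].
have [sr2 sa2] := sm2.
have gr2 : graph st2 by split; rewrite ?sr2 ?sa2.
have r3' : reg st2 3 = v by rewrite sr2.
have r4' : reg st2 4 = reg st 4 by rewrite sr2.
have rc' : reg st2 6 = reg st 6 by rewrite sr2.
have mk' : arr st2 (a_mark true) v = (v \in A true) by rewrite sa2 // -(mk true v).
have ps' d : arr st2 (a_prd true) d <= s by rewrite sa2 //; apply: (ps true).
have sd' : side s k L (A true) (h true) v.+1 (reg st2 6) (arr st2 (a_prd true))
    (arr st2 (a_up true)) (meets st) act.
  by rewrite rc' !sa2 //; apply: (sds true).
apply: wp_weaken (scan_wp vs gr2 r3' r4' hik erefl mk' ps' sd') (leqnn _) _.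
move=> st3 [sm3 ps3 up3 [c3 hc3 md3]]; have [sr3 sa3] := sm3.
split.
- have sm1 : same [:: 3] [::] st st1 by same_tac.
  have sm1' := same_sub (rs' := [:: 3; 9; 10; 7; 5; 8; 6]) (arrs' := [:: 6; 8; 7; 9]) sm1 isT.
  exact: same_trans (same_trans sm1' sm2 isT) sm3 isT.
- by rewrite sr3.
- by case=> // d; rewrite sa3.
- case; first by rewrite up3 sa2.
  by rewrite /= sa3 // up2 sa3.
- case; first by exists c3 => //; rewrite sa2 in md3.
  by exists c2 => //=; rewrite /= !sr3 // sa3.
Qed.

Definition combined v (act : nat -> bool) st' st2 := exists act',
    [/\ same [:: 10; 11] [:: 6; 7; 12] st' st2,
     forall sd d, arr st2 (a_prd sd) d <= s,
     forall sd, side s k L (A sd) (h sd) v (reg st2 (r_cnt sd)) (arr st2 (a_prd sd))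
       (arr st2 (a_up sd)) (meets st2) act' &
     [/\ forall u, settled (A false) v (arr st2 (a_up false)) u ->
          settled (A true) v (arr st2 (a_up true)) u -> u \in meets st2,
         uniq (meets st2) /\ (forall x, x \in meets st2 -> x <= s),
         count act' (iota 1 k) + reg st2 11 = k &
         forall c, act' c -> act c]].

Lemma combine_wp v act st st' : sweep_inv v.+1 act st -> scanned v act st st' ->
  wp W combine 60 (combined v act st') st'.
Proof.
case=> gr r3 vs hik mk ps sds both [uM Ms] cnt_k act_hi [sm r3' ps' up' mds].
rewrite ltnS in vs; have [sr sa] := sm.
have [c hc md] := mds false; have [c' hc' md'] := mds true.
have r11 : reg st' 11 = reg st 11 by rewrite sr.
have r11k : reg st 11 <= k by lia.
have a12 : arr st' 12 = arr st 12 by rewrite sa.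
have mE : meets st' = meets st by rewrite /meets r11 a12.
have actc d : act d -> d < c by move/act_hi; lia.
have actc' d : act d -> d < c' by move/act_hi; lia.
have vM := mid_notin md.
have nv B up : settled B v.+1 up v = false by rewrite /settled ltnn.
have := (ps' false, ps' true); have := (up' false, up' true).
have [lk lk'] := (mid_last_cnt md, mid_last_cnt md').
move: md md' lk lk' => /=; set l := reg st' 7; set l' := reg st' 8.
move=> md md' lk lk' [uE u'E] [p p'].
(* At most one end has settled at [v], so no meeting arises; this serves the two branches of
   [combine] that run [plain]. *)
have plain_case : (l = 0 \/ l' = 0) -> vc W plain (combined v act st') st'.
  move=> l0; rewrite /= /upd /= -/l -/l' r3'; split; [lia | lia | split; [lia | lia |]].
  have lv : l <= size (L v) /\ l' <= size (L v).
    case: l0 => l0; rewrite l0; split=> //.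
      exact: mid_last_le actc md md' l0.
    exact: mid_last_le actc' md' md l0.
  exists act; split.
  - by same_tac.
  - by case=> d; rewrite /= /upd /=; [case: (d == l') | case: (d == l)].
  - case; rewrite -[meets _]/(meets st') mE.
      by have := finish_plain L_left md' vs vM actc' (proj2 lv); rewrite -u'E.
    by have := finish_plain L_left md vs vM actc (proj1 lv); rewrite -uE.
  - rewrite -[meets _]/(meets st') mE; split=> //; last by rewrite r11.
    move=> u; rewrite -[arr _ (a_up false)]/(arr st' 8) -[arr _ (a_up true)]/(arr st' 9) uE u'E.
    move=> /(mid_settled md) s1 /(mid_settled md') s2.
    by case: s1 s2 => [s1|[-> ?]] [s2|[e ?]]; [exact: both | | | lia];
      [rewrite e nv in s1 | rewrite nv in s2].
apply: wp_vc => //; rewrite /combine [vc _ _ _ _]/= -/l -/l'.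
split; first by split; lia.
case: eqP => [l0|/eqP l0]; first by apply: plain_case; left.
split; first by split; lia.
case: eqP => [l'0|/eqP l'0]; first by apply: plain_case; right.
have [al al'] : act l /\ act l'.
  by split; [rewrite (mid_act md) | rewrite (mid_act md')]; rewrite ?eqxx //; lia.
have lsr : act (maxn l l') by rewrite /maxn; case: ifP.
rewrite /upd /= r3' r11; set i := reg st 11.
have pl' := p l'; have p'l := p' l.
rewrite -/l -/l' -maxnE; set mx := maxn l l' in lsr *.
do ?[split; try lia].
set st2 := set_arr _ 7 mx 0.
have m2 : meets st2 = rcons (meets st) v.
  by rewrite /meets /st2 /= /upd /= addn1 mkseqS eqxx a12; congr rcons;
    apply/eq_in_map => j; rewrite mem_iota => /andP[_ ji]; rewrite ifN //; lia.
exists (fun d => act d && (d != mx)); split.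
- by rewrite /st2; same_tac.
- by case=> d; rewrite /st2 /= /upd /=; do ?case: (_ == _).
(* Both ends retire the same colour: the lemma is applied with the two colours exchanged, and [maxn]
   is commutative. *)
- have H := finish_meet L_sorted md actc _ _ al'.
  have H' := finish_meet L_sorted md' actc' _ _ al.
  rewrite -lt0n in l0; rewrite -lt0n in l'0.
  case; rewrite m2.
    by have := H' l'0 l0; rewrite maxnC -u'E.
  by have := H l0 l'0; rewrite -uE.
- rewrite m2; split.
  + move=> u; rewrite -[arr _ (a_up false)]/(arr st' 8) -[arr _ (a_up true)]/(arr st' 9) uE u'E.
    rewrite mem_rcons inE.
    move=> /(mid_settled md) s1 /(mid_settled md') s2.
    case: s1 s2 => [s1|[-> _]] [s2|[e ?]]; rewrite ?eqxx //; last by rewrite e eqxx.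
    by rewrite both ?orbT.
  + rewrite rcons_uniq vM uM; split=> // x; rewrite mem_rcons inE => /orP[/eqP->//|].
    exact: Ms.
  + have := count_drop (iota_uniq 1 k) _ lsr; rewrite /st2 /= /upd /= => H.
    have : mx \in iota 1 k by rewrite mem_iota /mx; lia.
    by move/H; lia.
  + by move=> d /andP[].
Qed.

(** This is why all [k] paths are found: with fewer meetings some colour is active, and at [b = 0]
    it would be at most the number of left neighbours of vertex 0, which is 0. *)
Lemma inv_gt0 b act st : sweep_inv b act st -> reg st 11 < k -> 0 < b.
Proof.
case=> _ _ bs hik _ _ sds _ _ cnt_k act_hi lt_k.
have /hasP[c0 _ act_c0] : has act (iota 1 k) by rewrite has_count; lia.
have c00 := act_hi _ act_c0; case: (posnP b) => // bE.
have := act_le L_mao (d := c0) _ _ (sds false) _ act_c0; rewrite bE => H.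
have : c0 <= size (L 0) by apply: H => //; [apply: A_count | lia].
by case: (L 0) (@L_left 0) => [|x l /(_ x)] /=; [lia | rewrite mem_head => /(_ isT)].
Qed.

Lemma step_wp b act hi st : sweep_inv b act st -> reg st 4 = hi -> reg st 11 < k ->
  wp W step (220 + 88 * hi) (fun st' => exists2 act', sweep_inv b.-1 act' st' &
    reg st' 4 = minn hi (size (L b.-1))) st.
Proof.
move=> iv r4 lt_k; have b0 := inv_gt0 iv lt_k.
case: iv => gr r3 bs hik mk ps sds both [uM Ms] cnt_k act_hi; rewrite r4 in hik act_hi.
case: b b0 r3 bs mk sds both => // v _ r3 vs mk sds both.
rewrite [_.-1]/=; rewrite ltnS in vs.
rewrite -r4 in act_hi hik *.
have iv : sweep_inv v.+1 act st by split.
apply: (@wp_weaken _ _ (130 + 88 * reg st 4 + (60 + 20))) (fun _ H => H); last lia.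
apply: wp_then; apply: wp_weaken (scan_both iv) (leqnn _) _ => st1 sc.
apply: wp_then; apply: wp_weaken (combine_wp iv sc) (leqnn _) _.
move=> st2 [act' [sm2 ps2 sd2 [both2 uM2 cnt2 act2]]].
have [sm1 r3' _ _ _] := sc; have [sr1 sa1] := sm1; have [sr2 sa2] := sm2.
have [r1 r2 a0 a1] := gr.
have [offv offv1] : off v <= m /\ off v.+1 <= m by have := off_le vs; lia.
have osz := off_size vs.
have v3 : reg st2 3 = v by rewrite sr2.
have v4 : reg st2 4 = reg st 4 by rewrite sr2 // sr1.
have o0 : arr st2 0 = off by rewrite sa2 // sa1.
have fin f : same [:: 4; 10] [::] st2 f ->
    reg f 4 = minn (reg st 4) (size (L v)) -> sweep_inv v act' f.
  case=> sr sa f4; have mE : meets f = meets st2 by rewrite /meets sr // sa.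
  split; rewrite ?mE //.
  - by split; rewrite ?sr ?sa // ?sr2 ?sa2 // ?sr1 ?sa1.
  - by rewrite sr.
  - by rewrite leqW.
  - by rewrite f4; lia.
  - move=> sd u uv; rewrite sa // -mk; last by rewrite ltnW.
    by rewrite sa2 ?sa1; case: (sd).
  - by move=> sd d; rewrite sa.
  - by move=> sd; rewrite sr ?sa //; case: (sd).
  - by rewrite !sa.
  - by rewrite sr.
  (* By [act_le], lowering the scan range to [size (L v)] loses no active colour. *)
  - move=> d ad; have := act_hi _ (act2 _ ad); rewrite f4 => /andP[d0 dhi].
    have := act_le L_mao vs (A_count false vs) (sd2 false) d0 ad.
    by lia.
apply: wp_vc => //; rewrite /lower_hi /= /upd /= v3 v4 o0 addn1 osz.
do ?[split; try lia].
case: ltnP => cmp; do ?[split; try lia]; exists act';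
  try (by apply: fin; [same_tac | rewrite /= /upd /=; lia]); lia.
Qed.

(** The number of colours scanned at one end if the sweep ran from boundary [b] down to vertex 0
    with initial scan range [hi]. *)
Fixpoint work b hi := if b is v.+1 then hi + work v (minn hi (size (L v))) else 0.

(** While a colour is active the scan range is positive, so the constant cost per vertex is
    absorbed, and the number of vertices passed is also at most the work. *)
Lemma sweep_wp b act st : sweep_inv b act st ->
  wp W sweep (10 + 320 * work b (reg st 4)) (fun st' => exists b', exists act',
    [/\ sweep_inv b' act' st', reg st' 11 = k & b - b' <= work b (reg st 4)]) st.
Proof.
move=> iv; pose w0 := work b (reg st 4).
pose I t st' := exists b' act', [/\ sweep_inv b' act' st', 10 + 320 * work b' (reg st' 4) <= t,
  b' <= b & b - b' + work b' (reg st' 4) <= w0].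
apply: (wp_while (I := I)); last by exists b, act; split=> //; rewrite /w0; lia.
move=> t {iv}st1 [b' [act' [iv tb bb wb]]] /=.
have [r1 _ _ _] := inv_graph iv; have cnt := inv_count iv.
split; first by lia.
case: ltnP => [lt|ge]; last first.
  by split; [lia | exists b', act'; split=> //; lia].
rewrite r1 in lt; have w := step_wp iv erefl lt.
have /hasP[c0 _ act_c0] : has act' (iota 1 k) by rewrite has_count; lia.
have hi0 := inv_act iv act_c0.
have b'0 := inv_gt0 iv lt.
exists (220 + 88 * reg st1 4), (10 + 320 * work b'.-1 (minn (reg st1 4) (size (L b'.-1)))).
split.
  apply: wp_weaken w (leqnn _) _ => st2 [act2 iv2 r4].
  exists b'.-1, act2; rewrite r4; split=> //; first lia.
  by case: (b') b'0 wb => //= v _; lia.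
by case: (b') b'0 tb => //= v _; lia.
Qed.

End Program.

(** * Writing the paths *)

Definition climbing a body :=
  While (Not (Eq (Get a (Reg 14)) (Const 0))) (Then (SetReg 14 (Get a (Reg 14))) body).

Definition count_up := SetReg 12 (Add (Reg 12) (Const 1)).

Definition write_down :=
  Then (SetReg 13 (Defs.Sub (Reg 13) (Const 1))) (Put 5 (Reg 13) (Reg 14)).

Definition write_up := Then (Put 5 (Reg 12) (Reg 14)) count_up.

Definition load := SetReg 14 (Get 12 (Reg 9)).

(* The links lead from the meeting vertex to both end vertices, so the half that
   belongs to the source is measured first and then written backwards. *)
Definition emit_path :=
  Then (Then (Put 4 (Reg 9) (Reg 12)) load)
  (Then (climbing 8 count_up)
  (Then (Then (SetReg 13 (Reg 12)) (Then load (Put 5 (Reg 13) (Reg 14))))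
  (Then (climbing 8 write_down)
  (Then (Then count_up load)
  (Then (climbing 9 write_up)
    (SetReg 9 (Add (Reg 9) (Const 1)))))))).

Definition emit :=
  Then (Then (SetReg 9 (Const 0)) (SetReg 12 (Const 0)))
  (Then (While (Lt (Reg 9) (Reg 1)) emit_path) (Put 4 (Reg 9) (Reg 12))).

Section Emit.

Variables (W s : nat).

Hypothesis W_gt : s < W.

(** [R i] describes the state after [i] links; the 8 extra steps per link pay for the test (5) and
    the move (3). *)
Lemma climbing_wp a body c u x (R : nat -> state -> Prop) st :
  rising s u -> x <= s ->
  (forall i st, R i st -> arr st a = u /\ reg st 14 = iter i u x) ->
  (forall i st, i < height s u x -> R i st ->
    wp W body c (R i.+1) (set_reg st 14 (iter i.+1 u x))) ->
  R 0 st ->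
  wp W (climbing a body) (5 + (c + 8) * height s u x) (R (height s u x)) st.
Proof.
move=> ru xs Rs Rstep R0.
pose I t st := exists i, [/\ i <= height s u x, R i st &
  5 + (c + 8) * (height s u x - i) <= t].
apply: (wp_while (I := I)); last by exists 0; rewrite subn0.
move=> t {R0}st [i [ih Ri tt]]; have [ua r14] := Rs _ _ Ri.
have i_le := iter_le ru xs ih.
have u_le : u (iter i u x) < W.
  by case: (u (iter i u x) =P 0) => [->|/eqP/ru]; lia.
rewrite /= ua r14 (iter_nz ru xs ih); split; first by split; lia.
case: ltnP => hi; last first.
  by split; first lia; have -> : height s u x = i by lia.
have Hi : height s u x - i = (height s u x - i.+1).+1 by lia.
rewrite Hi mulnS in tt.
exists (c + 3), (5 + (c + 8) * (height s u x - i.+1)); split; last by lia.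
rewrite addnC; apply: wp_then; apply: wp_vc => //=; rewrite ua r14; split; first lia.
apply: wp_weaken (Rstep i st hi Ri) (leqnn _) _ => st' R'; exists i.+1; split=> //.
Qed.

Variable k : nat.
Hypothesis W_big : 3 * (s + k) + 20 < W.

Lemma emit_path_wp u u' j p x st : rising s u -> rising s u' -> x <= s ->
  arr st 8 = u -> arr st 9 = u' -> arr st 12 j = x -> reg st 9 = j -> j < k ->
  reg st 12 = p -> p + size (joined s u u' x) <= 2 * s + k + 5 ->
  wp W emit_path (60 + 30 * size (joined s u u' x)) (fun st' =>
    [/\ same [:: 9; 12; 13; 14] [:: 4; 5] st st',
        reg st' 9 = j.+1 /\ reg st' 12 = p + size (joined s u u' x),
        arr st' 4 = upd (arr st 4) j p,
        forall q, q < p -> arr st' 5 q = arr st 5 q &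
        forall q, q < size (joined s u u' x) -> arr st' 5 (p + q) = nth 0 (joined s u u' x) q]) st.
Proof.
rewrite size_joined => ru ru' xs a8 a9 a12 r9 jk r12 p_le.
set H := height s u x in p_le *; set H' := height s u' x in p_le *.
apply: (@wp_le _ _ (9 + ((5 + (4 + 8) * H) + (10 + ((5 + (7 + 8) * H) +
  (10 + ((5 + (7 + 8) * H') + 4))))))); last lia.
apply: wp_then; apply: wp_vc => //=; rewrite /upd /= r9 r12 a12.
do ?[split; try lia].
have itW i : i <= H -> iter i u x < W by move=> ih; have := iter_le ru xs ih; lia.
have itW' i : i <= H' -> iter i u' x < W by move=> ih; have := iter_le ru' xs ih; lia.
(* First climb: the source half is only measured, in register 12. *)
pose R1 i st' := [/\ same [:: 12; 14] [:: 4] st st', arr st' 4 = upd (arr st 4) j p,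
  reg st' 14 = iter i u x & reg st' 12 = p + i].
apply: wp_then; apply: (wp_le (t := 5 + (4 + 8) * H)) => //.
set st1 := set_reg _ 14 x.
have R10 : R1 0 st1 by split; rewrite ?addn0 /st1 //; same_tac.
apply: wp_weaken (climbing_wp (R := R1) ru xs _ _ R10) (leqnn _) _.
- by move=> i st' [[_ sa] _ -> _]; rewrite sa.
- move=> i st' ih [sm a4 r14 r12']; apply: wp_vc => //=; rewrite /upd /= r12'.
  split; first by split; lia.
  split; rewrite /= /upd //=; last by lia.
  by apply: same_trans sm _ (isT : all (mem [:: 12; 14]) [:: 12; 14] && all (mem [:: 4]) [::]); same_tac.
move=> {R10}st1 [sm1 a41 r14 r121]; have [sr1 sa1] := sm1.
(* Second climb: register 13 descends from [p + H], the cell of the meeting vertex, so the source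
   half comes out reversed. *)
pose R2 i st' := [/\ same [:: 12; 13; 14] [:: 4; 5] st st', arr st' 4 = upd (arr st 4) j p,
  [/\ reg st' 14 = iter i u x, reg st' 13 = p + H - i & reg st' 12 = p + H],
  forall q, q < p -> arr st' 5 q = arr st 5 q &
  forall q, q <= i -> arr st' 5 (p + H - q) = iter q u x].
have r91 : reg st1 9 = j by rewrite sr1.
have a121 : arr st1 12 j = x by rewrite sa1.
apply: wp_then; apply: (wp_vc (t := 10)) => //=; rewrite /upd /= r121 r91 a121.
do ?[split; try lia].
set st2 := set_arr _ _ _ _.
have R20 : R2 0 st2.
  split=> //.
  - apply: same_trans (same_sub (rs' := [:: 12; 13; 14]) (arrs' := [:: 4; 5]) sm1 isT) _
      (isT : all (mem [:: 12; 13; 14]) [:: 13; 14] && all (mem [:: 4; 5]) [:: 5]).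
    by rewrite /st2; same_tac.
  - by rewrite /st2 /= /upd /= subn0.
  - by move=> q qp; rewrite /st2 /= /upd /= ifN ?sa1 //; lia.
  - by move=> q; rewrite leqn0 => /eqP->; rewrite /st2 /= /upd /= subn0 eqxx.
apply: wp_then; apply: (wp_le (t := 5 + (7 + 8) * H)) => //.
apply: wp_weaken (climbing_wp (R := R2) ru xs _ _ R20) (leqnn _) _.
- by move=> i st' [[_ sa] _ [-> _ _] _ _]; rewrite sa.
- move=> i st' ih [sm a4 [r14' r13' r12'] lo hi]; apply: wp_vc => //=; rewrite /upd /= r13'.
  have := itW _ ih => /= ?.
  do ?[split; try lia]; rewrite /= /upd //=; try lia.
  + by case: sm => sr _ r rn; rewrite -sr //; move: r rn; same_tac.
  + by case: sm => _ sa r rn; rewrite -sa //; move: r rn; same_tac.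
  + by move=> q qp; rewrite ifN ?lo //; lia.
  + move=> q; rewrite leq_eqVlt => /orP[/eqP->|qi]; first by rewrite ifT //; lia.
    by rewrite ifN ?hi //; lia.
move=> {R20}st3 [sm3 a43 [r143 r133 r123] lo hi]; have [sr3 sa3] := sm3.
(* Third climb: the meeting vertex is already written, so the target half begins at cell
   [p + H + 1]. *)
pose R3 i st' := [/\ same [:: 12; 13; 14] [:: 4; 5] st st', arr st' 4 = upd (arr st 4) j p,
  reg st' 14 = iter i u' x /\ reg st' 12 = p + H + 1 + i,
  forall q, q < p + H.+1 -> arr st' 5 q = arr st3 5 q &
  forall q, 0 < q <= i -> arr st' 5 (p + H + q) = iter q u' x].
have r93 : reg st3 9 = j by rewrite sr3.
have a123 : arr st3 12 j = x by rewrite sa3.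
apply: wp_then; apply: (wp_vc (t := 10)) => //=; rewrite /upd /= r123 r93 a123.
do ?[split; try lia].
set st4 := set_reg _ 14 x.
have R30 : R3 0 st4.
  split; rewrite ?addn0 //.
  - apply: same_trans sm3 _
      (isT : all (mem [:: 12; 13; 14]) [:: 12; 14] && all (mem [:: 4; 5]) [::]).
    by rewrite /st4; same_tac.
  - by move=> q; lia.
apply: wp_then; apply: wp_weaken (climbing_wp (R := R3) ru' xs _ _ R30) (leqnn _) _.
- by move=> i st' [[_ sa] _ [-> _] _ _]; rewrite sa.
- move=> i st' ih [sm a4 [r14' r12'] lo' hi']; apply: wp_vc => //=; rewrite /upd /= r12'.
  have := itW' _ ih => /= ?; rewrite -/H in r123.
  do ?[split; try lia]; rewrite /= /upd //=; try lia.
  + by case: sm => sr _ r rn; rewrite -sr //; move: r rn; same_tac.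
  + by case: sm => _ sa r rn; rewrite -sa //; move: r rn; same_tac.
  + by move=> q qp; rewrite ifN ?lo' //; lia.
  + move=> q /andP[q0]; rewrite leq_eqVlt => /orP[/eqP->|qi]; first by rewrite ifT //; lia.
    by rewrite ifN ?hi' //; lia.
move=> st5 [sm5 a45 [r145 r125] lo5 hi5]; have [sr5 sa5] := sm5.
apply: (wp_vc (t := 4)) => //=; have -> : reg st5 9 = j by rewrite sr5.
do ?[split; try lia]; rewrite /= /upd //=.
- move=> r rn; have -> : (r == 9) = false by move: rn; rewrite !inE; case: eqP.
  by rewrite sr5 //; apply: contra rn; rewrite !inE => /or3P[]->; rewrite ?orbT.
- by rewrite addn1.
- by rewrite r125; lia.
- by move=> q qp; rewrite lo5 ?lo //; lia.
- move=> q qH; rewrite nth_joined //; case: leqP => qh.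
    rewrite lo5; last by rewrite -/H in qh; lia.
    by rewrite -hi; last lia; congr (arr st3 5 _); rewrite -/H in qh *; lia.
  by rewrite -hi5; last (by rewrite -/H -/H' in qh *; lia); congr (arr st5 5 _);
    rewrite -/H in qh *; lia.
Qed.

Lemma emit_wp u u' st : rising s u -> rising s u' ->
  (forall x, x \in meets st -> x <= s) ->
  \sum_(x <- meets st) height s u x <= s.+1 ->
  \sum_(x <- meets st) height s u' x <= s.+1 ->
  arr st 8 = u -> arr st 9 = u' -> reg st 1 = k -> reg st 11 = k ->
  wp W emit (100 + 100 * k + 30 * (\sum_(x <- meets st) height s u x +
      \sum_(x <- meets st) height s u' x))
    (fun st' => holds_lists st' 4 5 (map (joined s u u') (meets st))) st.
Proof.
move=> ru ru' Ms Hs Hs' a8 a9 r1 r11.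
set M := meets st in Ms Hs Hs' *; set J := joined s u u'.
have sM : size M = k by rewrite /M /meets size_mkseq.
have sJ : size (map J M) = k by rewrite size_map.
pose T j := sumn (take j (shape (map J M))).
have T0 : T 0 = 0 by rewrite /T take0.
have TE j : T j = \sum_(x <- take j M) (height s u x + height s u' x).+1.
  rewrite /T /shape -map_comp -map_take sumnE big_map; apply: eq_bigr => x _ /=.
  by rewrite size_joined.
have Tk : T k = \sum_(x <- M) height s u x + \sum_(x <- M) height s u' x + k.
  rewrite TE take_oversize ?sM //.
  under eq_bigr => x _ do rewrite -addn1.
  by rewrite big_split big_split /= sum1_size sM.
have TS j : j < k -> T j.+1 = T j + size (J (nth 0 M j)).
  by move=> jk; rewrite !TE (take_nth 0) ?sM // -cats1 big_cat big_seq1 /= size_joined.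
have T_mono j : j <= k -> T j <= T k.
  have kE : take k (shape (map J M)) = shape (map J M) by rewrite take_oversize // /shape size_map size_map sM.
  by move=> jk; rewrite /T kE -{2}(cat_take_drop j (shape _)) sumn_cat leq_addr.
have szT j : size (flatten (map J (take j M))) = T j.
  by rewrite size_flatten /T /shape !map_take.
(* The heights at each end add up to at most [s.+1], and each path has one meeting vertex; so all
   offsets are words. *)
have W_T : T k <= 2 * s + k + 2 by rewrite Tk; lia.
pose I t st' := exists j, [/\ same [:: 9; 12; 13; 14] [:: 4; 5] st st',
  [/\ j <= k, reg st' 9 = j, reg st' 12 = T j &
    80 + 70 * (k - j) + 30 * (T k - T j) <= t],
  forall i, i < j -> arr st' 4 i = T i &
  forall q, q < T j -> arr st' 5 q = nth 0 (flatten (map J (take j M))) q].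
apply: (@wp_le _ _ (10 + ((80 + 70 * k + 30 * T k) + 10))); last by rewrite Tk; lia.
apply: wp_then; apply: wp_vc => //=; split; first lia.
split; first lia.
apply: wp_then.
set st1 := set_reg _ 12 0.
have I1 : I (80 + 70 * k + 30 * T k) st1.
  exists 0; split=> //; last by rewrite T0.
  - by rewrite /st1; same_tac.
  - by split=> //; rewrite ?T0 //; lia.
apply: (wp_while (I := I)) I1 => t {}st1 [j [[sr sa] [jk r9 r12 tt] a4 a5]].
have r1' : reg st1 1 = k by rewrite sr.
rewrite /= r9 r1'; split; first by split; lia.
case: ltnP => [lt|ge]; last first.
  have jE : j = k by lia.
  split; first lia; apply: wp_vc => //=; rewrite r9 r12 jE.
  have Tkk := T_mono k (leqnn _).
  split; [lia | lia | split].
  - move=> i; rewrite sJ => ik; rewrite /offsets (nth_map 0) ?size_iota ?sJ // nth_iota ?sJ //.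
    rewrite add0n -/(T i) /= /upd /=; case: (i =P k) => [->//|/eqP ne].
    by apply: a4; lia.
  - move=> q; rewrite -[X in map J X](take_oversize (n := j)) ?sM // szT => qT.
    by rewrite -[arr _ 5]/(arr st1 5) a5.
have jM : nth 0 M j \in M by rewrite mem_nth // sM.
have MjE : arr st1 12 j = nth 0 M j by rewrite sa // /M /meets nth_mkseq // r11.
have Tj := TS j lt; have := T_mono _ lt; rewrite Tj => T_le.
have w := @emit_path_wp u u' j (T j) (nth 0 M j) st1 ru ru' (Ms _ jM).
have {}w := w _ _ MjE r9 lt r12 _.
exists (60 + 30 * size (J (nth 0 M j))), (80 + 70 * (k - j.+1) + 30 * (T k - T j.+1)); split; last by lia.
apply: wp_weaken (w _ _ _) (leqnn _) _; try by rewrite sa.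
  by rewrite -/J; lia.
move=> st2 [sm2 [r9' r12'] a4' a5' a5'']; exists j.+1; split.
- exact: same_trans (conj sr sa) sm2 isT.
- by rewrite Tj; split.
- move=> i ij; rewrite a4' /upd; case: eqP => [->//|ne]; apply: a4; lia.
- move=> q; rewrite Tj (take_nth 0) ?sM // map_rcons flatten_rcons nth_cat szT.
  case: (ltnP q (T j)) => [qT _|qT]; first by rewrite (a5' _ qT); apply: a5.
  move=> qT2; have qT3 : q - T j < size (joined s u u' (nth 0 M j)) by rewrite -/J; lia.
  by rewrite -[in LHS](subnKC qT) a5''.
Qed.

End Emit.

(** * Forests of a maximal adjacency ordering *)

Section Graph.

Variables (n : nat) (e : rel 'I_n).

Definition lefts (u : nat) : seq nat := nth [::] (nbr_lists e) u.

Lemma lefts_ord (v : 'I_n) : lefts v = map val (left_nbrs e v).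
Proof. by rewrite /lefts /nbr_lists (nth_map v) ?size_enum_ord // nth_ord_enum. Qed.

Lemma lefts_out u : n <= u -> lefts u = [::].
Proof. by move=> nu; rewrite /lefts nth_default // size_map size_enum_ord. Qed.

Lemma size_lefts (v : 'I_n) : size (lefts v) = size (left_nbrs e v).
Proof. by rewrite lefts_ord size_map. Qed.

Lemma left_nbrsP (v w : 'I_n) : w \in left_nbrs e v = (w < v) && e v w.
Proof. by rewrite mem_filter mem_enum andbT. Qed.

Lemma left_nbrs_uniq v : uniq (left_nbrs e v).
Proof. by rewrite filter_uniq ?enum_uniq. Qed.

Lemma lefts_sorted u : sorted ltn (lefts u).
Proof.
case: (ltnP u n) => [un|/lefts_out->//]; rewrite -[u]/(val (Ordinal un)) lefts_ord.
apply: (subseq_sorted ltn_trans _ (iota_ltn_sorted 0 n)).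
by rewrite -val_enum_ord; apply/map_subseq/filter_subseq.
Qed.

Lemma lefts_left u (x : nat) : x \in lefts u -> x < u.
Proof.
case: (ltnP u n) => [un|/lefts_out->//]; rewrite -[u]/(val (Ordinal un)) lefts_ord.
by case/mapP => w; rewrite left_nbrsP => /andP[? _] ->.
Qed.

Lemma count_lefts (v : nat) (x : 'I_n) : v <= x ->
  count (ltn^~ v) (lefts x) = #|[set y : 'I_n | (y < v) && e x y]|.
Proof.
move=> vx; rewrite lefts_ord count_map count_filter -size_filter.
rewrite -(card_uniqP (filter_uniq _ (enum_uniq _))); apply: eq_card => y.
rewrite mem_filter mem_enum inE andbT /=.
by case: (ltnP y v) => //= yv; rewrite (leq_trans yv vx).
Qed.

(** The first [c] left neighbours of [x] all lie below [v], so [x] has at least [c] neighbours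
    there, and the ordering gives [v] at least as many. *)
Lemma lefts_mao (v x c : nat) : MAO e -> v < x < n -> 0 < c <= size (lefts x) ->
  nth 0 (lefts x) c.-1 < v -> c <= size (lefts v).
Proof.
move=> mao /andP[vx xn] c_le lt; have vn := ltn_trans vx xn.
have -> : size (lefts v) = count (ltn^~ v) (lefts v).
  by apply/esym/eqP; rewrite -all_count; apply/allP => y; apply: lefts_left.
rewrite (count_lefts (x := Ordinal vn)) //; apply: leq_trans (mao (Ordinal vn) (Ordinal xn) vx).
rewrite -(count_lefts (x := Ordinal xn) (ltnW vx)) /=.
rewrite -[X in count _ X](cat_take_drop c) count_cat.
have /eqP -> : count (ltn^~ v) (take c (lefts x)) == size (take c (lefts x)).
  rewrite -all_count; apply/(all_nthP 0) => i; rewrite size_takel; last lia.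
  move=> ic; rewrite nth_take //=; apply: leq_ltn_trans lt.
  case: (ltngtP i c.-1) => [lt|?|->] //; last lia.
  by apply/ltnW/(sorted_ltn_nth ltn_trans 0 (lefts_sorted x)); rewrite ?inE; lia.
by rewrite size_takel; lia.
Qed.

(** Every pair in [X] is counted at its larger end only. *)
Lemma sum_deg_le (X : {set {set 'I_n}}) :
  \sum_(u < n) #|[set w : 'I_n | (w < u) && ([set u; w] \in X)]| <= #|X|.
Proof.
pose D := [set p : 'I_n * 'I_n | (p.2 < p.1) && ([set p.1; p.2] \in X)].
have -> : \sum_(u < n) #|[set w : 'I_n | (w < u) && ([set u; w] \in X)]| = #|D|.
  rewrite -sum1_card (eq_bigl (fun p : 'I_n * 'I_n => (p.2 < p.1) && ([set p.1; p.2] \in X))); last first.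
    by move=> p; rewrite inE.
  rewrite -(pair_big_dep predT (fun u w : 'I_n => (w < u) && ([set u; w] \in X)) (fun _ _ => 1)) /=.
  by apply: eq_bigr => u _; rewrite sum1_card cardsE.
have inj : {in D &, injective (fun p : 'I_n * 'I_n => [set p.1; p.2])}.
  move=> [u w] [u' w']; rewrite !inE /= => /andP[wu _] /andP[wu' _] E.
  have := set21 u w; have := set22 u w; rewrite E !inE.
  move=> /orP[]/eqP ? /orP[]/eqP ?; subst=> //; lia.
rewrite -(card_in_imset inj); apply: subset_leq_card.
by apply/subsetP => E /imsetP[p]; rewrite inE => /andP[_ ?] ->.
Qed.

Lemma sum_lefts_le : \sum_(u < n) size (lefts u) <= #|edges e|.
Proof.
apply: leq_trans (sum_deg_le _); apply: leq_sum => u _.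
rewrite size_lefts -(card_uniqP (left_nbrs_uniq u)); apply: subset_leq_card.
apply/subsetP => w; rewrite left_nbrsP inE => /andP[-> uw] /=.
by apply/imset2P; exists u w; rewrite ?inE.
Qed.

Lemma size_flatten_nbr : size (flatten (nbr_lists e)) = \sum_(u < n) size (lefts u).
Proof.
rewrite size_flatten /shape -map_comp sumnE big_map big_enum /=.
by apply: eq_bigr => u _; rewrite size_lefts size_map.
Qed.

Lemma trees_edges_sub (s : 'I_n) k : trees_edges e s k \subset edges e.
Proof.
apply/bigcupsP => i _; apply/subsetP => E /imset2P[u v _].
rewrite inE => /andP[_ /andP[_ f]] ->.
have Hn (x y : 'I_n) : onth (left_nbrs e y) i == Some x -> e y x.
  move=> /eqP H; have : x \in left_nbrs e y by apply/onthP; exists i.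
  by rewrite left_nbrsP => /andP[].
case/orP: f => /Hn evu; apply/imset2P; [exists v u | exists u v] => //.
- by rewrite inE.
- by rewrite setUC.
- by rewrite inE.
Qed.

Lemma forest_sym i : symmetric (forest e i).
Proof. by move=> u v; rewrite /forest orbC. Qed.

Lemma onth_lefts (v w : 'I_n) i : onth (left_nbrs e v) i = Some w ->
  i < size (lefts v) /\ nth 0 (lefts v) i = w.
Proof.
move=> H; have iv : i < size (left_nbrs e v).
  by rewrite ltnNge; apply/negP => /onth_default; rewrite H.
split; first by rewrite size_lefts.
by rewrite lefts_ord (nth_map v) //; congr val; apply: onth_nth.
Qed.

Lemma onth_left_nbrs (v : 'I_n) i : i < size (lefts v) ->
  exists w : 'I_n, [/\ onth (left_nbrs e v) i = Some w, nth 0 (lefts v) i = w & w < v].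
Proof.
rewrite size_lefts => iv; exists (nth v (left_nbrs e v) i); split.
- by rewrite onthE (nth_map v).
- by rewrite lefts_ord (nth_map v).
- by have := mem_nth v iv; rewrite left_nbrsP => /andP[].
Qed.

Hypothesis mao : MAO e.
Variable s : 'I_n.

(** No forest edge of index [i] leaves the vertices from [v] on: [v] has no left edge of this index,
    and one from above [v] to below [v] would give [v] more than [i] left neighbours. Contraposition
    turns [r_i <= t_i < v] into [i < size (lefts v)]. *)
Lemma tree_root_ge (v : nat) i : v <= s -> size (lefts v) <= i -> v <= tree_root e s i.
Proof.
move=> vs vi.
have tree_ge (y : 'I_n) : y \in tree e s i -> v <= y.
  rewrite inE => /connectP[p]; elim/last_ind: p y => [|p x IH] y /=; first by move=> _ ->.
  rewrite rcons_path last_rcons => /andP[pp f] ->; have {IH pp} := IH _ pp erefl.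
  set z := last s p in f * => vz; case/orP: f => /eqP/onth_lefts[i_lt nthE].
    by have := @lefts_left x z; rewrite -nthE mem_nth // => /(_ isT); rewrite nthE; lia.
  rewrite leqNgt; apply/negP => xv; have := @lefts_mao v z i.+1 mao.
  move: vz; rewrite leq_eqVlt => /orP[/eqP e0|vz]; first by move: i_lt; rewrite -e0; lia.
  by rewrite vz ltn_ord i_lt nthE => /(_ isT isT xv); lia.
rewrite /tree_root; case: arg_minnP => [|y yt _]; first by rewrite inE connect0.
exact: tree_ge.
Qed.

(** Let [r] be the largest vertex up to [s] with at most [i] left neighbours. Each vertex between
    [r] and [s] other than [r] has a smaller forest neighbour, which by the ordering is not below
    [r]. So descents from [u] and from [s] both end at [r]. *)
Lemma tree_connect (u : 'I_n) i : u <= s ->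
  (forall y, u <= y <= s -> i < size (lefts y)) -> u \in tree e s i.
Proof.
move=> us high.
have ex0 : exists y, size (lefts y) <= i.
  exists 0; case: (lefts 0) (@lefts_left 0) => // x l /(_ x).
  by rewrite mem_head => /(_ isT).
have bnd y : (y <= s) && (size (lefts y) <= i) -> y <= s by case/andP.
have ex1 : exists y, (y <= s) && (size (lefts y) <= i).
  exists 0; case: (lefts 0) (@lefts_left 0) => // x l /(_ x).
  by rewrite mem_head => /(_ isT).
case: (ex_maxnP ex1 bnd) => r /andP[rs ri] rmax.
have rn : r < n by apply: leq_ltn_trans rs (ltn_ord s).
pose ro := Ordinal rn.
have conn m : forall y : 'I_n, y < m -> r <= y <= s -> connect (forest e i) ro y.
  elim: m => // m IH y ym /andP[]; rewrite leq_eqVlt => /orP[/eqP ry _|ry ys].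
    by have -> : y = ro by [apply: val_inj].
  have iy : i < size (lefts y).
    by rewrite ltnNge; apply/negP => yi; have := rmax y; rewrite ys yi => /(_ isT); lia.
  have [w [wE nE wy]] := onth_left_nbrs iy.
  have rw : r <= w.
    rewrite leqNgt; apply/negP => wr; have := @lefts_mao r y i.+1 mao.
    by rewrite ry ltn_ord iy nE => /(_ isT isT wr); lia.
  apply: connect_trans (IH w _ _) _; [lia | lia | apply: connect1].
  by rewrite /forest wE eqxx.
have ru : r < u.
  by rewrite ltnNge; apply/negP => ur; have := high r; rewrite ur rs => /(_ isT); lia.
rewrite inE; apply: connect_trans (conn n u (ltn_ord u) _); last by lia.
rewrite (sym_connect_sym (forest_sym i)).
by apply: (conn n); [apply: ltn_ord | rewrite rs leqnn].
Qed.

(** The [hi] colours scanned at [b] are charged to the edges from [b.+1] to its first [hi] left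
    neighbours. By [tree_connect] these edges lie in the trees, as all vertices from [b.+1] to [s]
    have at least [hi] left neighbours. *)
Lemma work_le k : k <= size (lefts s) -> work lefts s k <= #|trees_edges e s k|.
Proof.
move=> ks; apply: leq_trans (sum_deg_le _).
pose deg (u : nat) := if (insub u : option 'I_n) is Some x then
  #|[set w : 'I_n | (w < x) && ([set x; w] \in trees_edges e s k)]| else 0.
have -> : \sum_(u < n) #|[set w : 'I_n | (w < u) && ([set u; w] \in trees_edges e s k)]|
    = \sum_(0 <= u < n) deg u.
  by rewrite big_mkord; apply: eq_bigr => u _; rewrite /deg valK.
suff H b hi : b <= s -> hi <= k -> (forall y, b <= y <= s -> hi <= size (lefts y)) ->
    work lefts b hi <= \sum_(0 <= u < b.+1) deg u.
  apply: leq_trans (H s k _ _ _) _ => //; first by move=> y; rewrite -eqn_leq => /eqP <-.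
  by rewrite [X in _ <= X](@big_cat_nat _ _ _ s.+1) ?ltn_ord //= leq_addr.
elim: b hi => [|b IH] hi bs hk high //=.
rewrite big_nat_recr //= addnC leq_add //.
  apply: IH; [lia | lia |] => y /andP[]; rewrite leq_eqVlt => /orP[/eqP <-|by_ ys].
    by rewrite geq_minr.
  by apply: leq_trans (geq_minl _ _) (high y _); rewrite by_.
have bn : b.+1 < n by apply: leq_ltn_trans bs (ltn_ord s).
rewrite /deg insubT; set x := Sub _ _.
have hx : hi <= size (left_nbrs e x) by rewrite -size_lefts; apply: high; rewrite /= leqnn.
have -> : hi = #|take hi (left_nbrs e x)|.
  by rewrite (card_uniqP _) ?size_takel // take_uniq ?left_nbrs_uniq.
apply: subset_leq_card; apply/subsetP => w wt; rewrite inE.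
have := mem_take wt; rewrite left_nbrsP => /andP[-> _] /=.
have wm := mem_take wt; have i_lt : index w (left_nbrs e x) < hi by rewrite -in_take.
have ik : index w (left_nbrs e x) < k by lia.
apply/bigcupP; exists (Ordinal ik) => //; apply/imset2P; exists x w => //=.
rewrite inE /=; apply/andP; split.
  by apply: tree_connect => // y yb; apply: leq_trans i_lt (high y yb).
by apply/orP; right; rewrite onthE (nth_map w) ?index_mem // nth_index // eqxx.
Qed.

End Graph.

(** * Correctness of the two programs *)

(** All [k] source threads count as started from [s], so the sweep begins below [s] and only targets
    remain to be reached. *)
Definition start_fan :=
  Then
    (While (Lt (Reg 9) (Reg 1))
       (Then (Put 11 (Get 2 (Reg 9)) (Const 1))
       (Then (Put 6 (Add (Reg 9) (Const 1)) (Reg 2))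
          (SetReg 9 (Add (Reg 9) (Const 1))))))
    (Then (SetReg 3 (Reg 2)) (Then (SetReg 4 (Reg 1)) (SetReg 6 (Reg 1)))).

(** Since [s] may belong to the source set, the sweep has to process it: the boundary is [s + 1]. *)
Definition start_linkage :=
  Then
    (While (Lt (Reg 9) (Reg 1))
       (Then (Put 11 (Get 2 (Reg 9)) (Const 1))
       (Then (Put 10 (Get 3 (Reg 9)) (Const 1))
          (SetReg 9 (Add (Reg 9) (Const 1))))))
    (Then (SetReg 3 (Add (Reg 2) (Const 1)))
    (Then (SetReg 4 (Reg 1)) (Then (SetReg 5 (Reg 1)) (SetReg 6 (Reg 1))))).

Section Paths.

Variables (n : nat) (e : rel 'I_n) (s : 'I_n) (k : nat).
Hypothesis e_sym : symmetric e.
Hypothesis mao : MAO e.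

Local Notation L := (lefts e).

Definition ords (p : seq nat) : seq 'I_n := map (insubd s) p.

Lemma ordsK p : all (ltn^~ n) p -> map val (ords p) = p.
Proof.
by move/allP => pn; rewrite -map_comp; apply: map_id_in => x /pn /= xn; rewrite val_insubd xn.
Qed.

Lemma val_ord (x : nat) : x < n -> val (insubd s x) = x.
Proof. by move=> xn; rewrite val_insubd xn. Qed.

Lemma adj_edge x y : x < n -> y < n -> adj L x y -> e (insubd s x) (insubd s y).
Proof.
have H a b : a < n -> b < n -> a \in L b -> e (insubd s a) (insubd s b).
  move=> an bn; rewrite -{1}(val_ord bn) lefts_ord => /mapP[w].
  rewrite left_nbrsP => /andP[_ ew] ->; rewrite e_sym.
  by have -> : insubd s (val w) = w by apply: val_inj; rewrite val_ord ?ltn_ord.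
by move=> xn yn /orP[xy|yx]; [apply: H | rewrite e_sym H].
Qed.

Lemma is_path_ords a q : (forall x, x \in a :: q -> x < n) ->
  path (adj L) a q -> uniq (a :: q) ->
  is_path e (insubd s a) (insubd s (last a q)) (ords (a :: q)).
Proof.
move=> pn pq uq; split=> //; last 1 first.
- rewrite map_inj_in_uniq // => x y xp yp /(congr1 val).
  by rewrite !val_ord ?pn.
- have : all (fun x => x < n) (a :: q) by apply/allP.
  elim: q a pq {pn uq} => //= b q IH a /andP[ab bq] /and3P[an bn qn].
  by rewrite adj_edge // IH //= bn.
- by rewrite last_map.
Qed.

Lemma init_reg0 ts r : 2 < r -> reg (input e k s ts) r = 0.
Proof. by case: r => [|[|[|[]]]]. Qed.

Lemma init_arr0 ts a i : size ts + 2 <= a -> arr (input e k s ts) a i = 0.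
Proof.
move=> sa; rewrite /= (nth_default [::]) ?nth_nil //=.
by rewrite size_map; lia.
Qed.

Definition off := nth 0 (offsets (nbr_lists e)).
Definition nb := nth 0 (flatten (nbr_lists e)).
Definition nedges := size (flatten (nbr_lists e)).

Lemma size_nbr : size (nbr_lists e) = n.
Proof. by rewrite size_map size_enum_ord. Qed.

Lemma offE x : x <= n -> off x = sumn (take x (shape (nbr_lists e))).
Proof.
move=> xn; rewrite /off /offsets (nth_map 0) ?size_iota ?size_nbr // nth_iota ?size_nbr //.
Qed.

Lemma offS x : x < n -> off x.+1 = off x + size (L x).
Proof.
move=> xn; rewrite !offE ?(ltnW xn) // (take_nth 0); last by rewrite /shape size_map size_nbr.
by rewrite sumn_rcons /shape (nth_map [::]) ?size_nbr.
Qed.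

Lemma off_le_m x : x <= n -> off x <= nedges.
Proof.
move=> xn; rewrite offE // /nedges size_flatten -{2}(cat_take_drop x (shape _)) sumn_cat.
exact: leq_addr.
Qed.

Lemma nb_nth x c : x < n -> 0 < c <= size (L x) -> nb (off x + c - 1) = nth 0 (L x) c.-1.
Proof.
move=> xn c_le; rewrite /nb -{1}(cat_take_drop x (nbr_lists e)) flatten_cat.
rewrite (drop_nth [::]) ?size_nbr // /= nth_cat.
have -> : size (flatten (take x (nbr_lists e))) = off x.
  by rewrite size_flatten offE ?(ltnW xn) // /shape map_take.
rewrite ifN; last lia.
rewrite nth_cat -/(L x) ifT; last lia.
by congr nth; lia.
Qed.

(** By [tree_root_ge], [t_i < v] forces [i < size (L v)], which leaves at most [size (L v)]
    indices. *)
Lemma count_starts (t : k.-tuple 'I_n) v : v <= s ->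
  (forall i : 'I_k, tree_root e s i <= tnth t i) ->
  count (ltn^~ v) (map val t) <= size (L v).
Proof.
move=> vs rt; rewrite -(map_tnth_enum t) -map_comp count_map.
apply: (@leq_trans (count (fun i : 'I_k => i < size (L v)) (enum 'I_k))).
  apply: sub_count => i /= tv; rewrite ltnNge; apply/negP => le.
  by have := tree_root_ge mao vs le; have := rt i; lia.
rewrite -(count_map val (ltn^~ (size (L v)))) val_enum_ord -size_filter.
rewrite -[X in _ <= X](size_iota 0); apply: uniq_leq_size.
  by rewrite filter_uniq ?iota_uniq.
by move=> i; rewrite mem_filter !mem_iota /= => /andP[].
Qed.

Variable W : nat.
Hypothesis W_big : 3 * (s + k) + nedges + 20 < W.

Let s_lt := ltn_ord s.

Let L_mao v x c : v < x <= s -> 0 < c <= size (L x) -> nth 0 (L x) c.-1 < v -> c <= size (L v).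
Proof. by move=> vx; apply: (lefts_mao mao); lia. Qed.

Let off_le x : x <= s -> off x <= off x.+1 <= nedges.
Proof. by move=> xs; have := offS (x := x); have := off_le_m (x := x.+1); lia. Qed.

Let off_size x : x <= s -> off x.+1 - off x = size (L x).
Proof. by move=> xs; have := offS (x := x); lia. Qed.

Let nb_nth_le x c : x <= s -> 0 < c <= size (L x) -> nb (off x + c - 1) = nth 0 (L x) c.-1.
Proof. by move=> xs; apply: nb_nth; lia. Qed.

Local Notation sweep_inv := (sweep_inv s k L off nb).

Definition found A h st' :=
    exists M u u' b',
    [/\ [/\ size M = k, uniq M & forall x : nat, x \in M -> x <= s],
        links s L (A false) (h false) b' u M, links s L (A true) (h true) b' u' M,
        forall x, settled (A false) b' u x -> settled (A true) b' u' x -> x \in M &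
        holds_lists st' 4 5 (map (joined s u u') M)].

Lemma run_wp A h b act st :
  (forall sd, uniq (A sd)) -> (forall sd, size (A sd) <= k) ->
  (forall sd v, v <= s -> count (ltn^~ v) (A sd) <= size (L v)) ->
  h false = 0 \/ h false = val s -> h true = 0 -> s <= b ->
  sweep_inv A h b act st -> reg st 4 = k ->
  wp W (Then sweep emit) (200 + 100 * k + 400 * work L b k) (found A h) st.
Proof.
move=> Au As Ac hF hT sb iv r4; pose w := work L b k.
apply: (@wp_le _ _ ((10 + 320 * w) + (100 + 100 * k + 30 * (w.+1 + w.+1)))); last by rewrite -/w; lia.
apply: wp_then; have := sweep_wp (@lefts_sorted _ e) (@lefts_left _ e) L_mao off_le off_size
  nb_nth_le W_big Au As Ac iv; rewrite r4 => w1.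
apply: wp_weaken w1 (leqnn _) _ => st1 [b' [act' [iv1 r11 b_le]]].
have [[r1 _ _ _] _ bs _ _ _ sds both [uM Ms] _ _] := iv1.
have lk := side_links (sds false); have lk' := side_links (sds true); rewrite hT in lk'.
have h0 : 0 = 0 \/ 0 = val s by left.
(* The sweep began at [s] or above and passed at most [w] vertices, so the heights at either end add
   up to at most [w.+1]. *)
have sum_le : s.+1 - b' <= w.+1 by have := inv_bs iv; rewrite /w; lia.
have sF := sum_height hF lk Ms uM; have sT := sum_height h0 lk' Ms uM.
have s_W : s < W by lia.
have big : 3 * (s + k) + 20 < W by lia.
have w2 := emit_wp s_W big (up_rising hF lk) (up_rising h0 lk') Ms _ _ erefl erefl r1 r11.
have w3 := w2 (leq_trans sF (leq_subr _ _)) (leq_trans sT (leq_subr _ _)).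
apply: wp_weaken w3 _ _.
  by rewrite leq_add2l leq_mul2l leq_add ?orbT //; [apply: leq_trans sF _ | apply: leq_trans sT _].
move=> st2 hl; exists (meets st1), (arr st1 8), (arr st1 9), b'; rewrite hT; split=> //.
by split; rewrite // /meets size_mkseq.
Qed.

Lemma links_none A h b up : (forall u, up u = 0) -> links s L A h b up [::].
Proof. by move=> up0; split=> // u; rewrite up0. Qed.

Lemma side_fresh A b prd up : (forall c, prd c = 0) -> (forall u, up u = 0) ->
  size A = k -> (forall x, x \in A -> x < b) ->
  side s k L A 0 b k prd up [::] (fun c => 0 < c <= k).
Proof.
move=> prd0 up0 sA Ab; split.
- exact: links_none.
- by rewrite -sA; apply/esym/eqP; rewrite -all_count; apply/allP.
- by move=> c _; rewrite prd0.
- by move=> c d _ _ _; rewrite prd0.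
- by move=> c u _ _; rewrite prd0.
- by move=> c c0; rewrite prd0 /= c0.
Qed.

(** All [k] threads sit at [s]; the exemption of the hub from injectivity allows this. *)
Lemma side_hub prd up : 0 < s -> k <= size (lefts e s) ->
  (forall c, prd c = if 0 < c <= k then val s else 0) ->
  (forall u, up u = 0) ->
  side s k L [:: val s] s s 0 prd up [::] (fun c => 0 < c <= k).
Proof.
move=> s_gt0 k_le prdE up0; have nz c : prd c != 0 -> 0 < c <= k /\ prd c = s.
  by rewrite prdE; case: ifP.
split.
- exact: links_none.
- by rewrite /= ltnn.
- move=> c c0 /nz[ck ->]; have cL : 0 < c <= size (L s) by lia.
  split=> //; [by rewrite /free /settled leqnn mem_head | by lia |].
  exact: (nbr_lt (@lefts_left _ e)).
- by move=> c d _ _ _ /nz[]; right.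
- by move=> c u _ _ /nz[].
- move=> c c0; have -> : (c <= 0) = false by lia.
  by rewrite orbF /= prdE; case: ifP => // _; apply/esym; rewrite -lt0n.
Qed.

Lemma start_inv A h b st : graph s k off nb st -> reg st 3 = b -> s <= b <= s.+1 ->
  reg st 4 = k -> reg st 11 = 0 ->
  (forall sd u, u < b -> arr st (a_mark sd) u = (u \in A sd)) ->
  (forall sd d, arr st (a_prd sd) d <= s) -> (forall sd u, arr st (a_up sd) u = 0) ->
  (forall x, x \in A true -> x < b) ->
  (forall sd, side s k L (A sd) (h sd) b (reg st (r_cnt sd)) (arr st (a_prd sd))
    (arr st (a_up sd)) [::] (fun c => 0 < c <= k)) ->
  sweep_inv A h b (fun c => 0 < c <= k) st.
Proof.
move=> gr r3 bs r4 r11 mk ps up0 Ab sds; have M0 : meets st = [::] by rewrite /meets r11.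
split; rewrite ?M0 ?r11 ?r4 //; first by lia.
- by move=> u _; rewrite /settled up0 orbF => /andP[bu /Ab]; lia.
- rewrite addn0 -[RHS](size_iota 1); apply/eqP; rewrite -all_count; apply/allP => c.
  by rewrite mem_iota; lia.
Qed.

Definition fan_starts (t : seq 'I_n) sd := if sd then map val t else [:: val s].
Definition fan_hub (sd : bool) := if sd then 0 else val s.

Lemma start_fan_wp (t : k.-tuple 'I_n) : 0 < s -> k <= size (lefts e s) ->
  uniq t -> (forall v, v \in tval t -> v < s) ->
  wp W start_fan (30 + 25 * k) (fun st =>
    sweep_inv (fan_starts t) fan_hub s (fun c => 0 < c <= k) st /\ reg st 4 = k)
  (input e k s [:: tval t]).
Proof.
move=> s_gt0 k_le ut ts; set st0 := input _ _ _ _; set T := map val t.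
have sT : size T = k by rewrite size_map size_tuple.
have Ts x : x \in T -> x < s by case/mapP => v /ts ? ->.
pose I tm st := exists j, [/\ same [:: 9] [:: 6; 11] st0 st,
  [/\ j <= k, reg st 9 = j & 10 + 24 * (k - j) <= tm],
  forall c, arr st 6 c = if 0 < c <= j then val s else 0 &
  forall u, arr st 11 u = (u \in take j T)].
apply: (@wp_le _ _ ((10 + 24 * k) + 10)); last lia.
apply: wp_then.
have I0 : I (10 + 24 * k) st0.
  exists 0; split=> //; first by rewrite subn0.
  - by move=> c; rewrite init_arr0 //; case: c.
  - by move=> u; rewrite init_arr0 // take0.
apply: (wp_while (I := I)) I0 => tm st [j [[sr sa] [jk r9 tt] a6 a11]].
have r1 : reg st 1 = k by rewrite sr.
have r2 : reg st 2 = s by rewrite sr.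
have a2 i : arr st 2 i = nth 0 T i by rewrite sa.
rewrite /= r9 r1; split; first by split; lia.
case: ltnP => [lt|ge]; last first.
  have jE : j = k by lia.
  split; first lia; apply: wp_vc => //=; rewrite /upd /= r1 r2.
  do 3![split; first lia]; split=> //.
  have gr : graph s k off nb st by split; rewrite ?sr ?sa.
  set st1 := set_reg _ 6 k; have up0 sd u : arr st1 (a_up sd) u = 0.
    by case: sd; rewrite /st1 /= sa // init_arr0.
  apply: start_inv => //; first by lia.
  - by rewrite /st1 /= /upd /= sr // init_reg0.
  - move=> sd u us; case: sd; first by rewrite [LHS]a11 jE take_oversize ?sT.
    (* No source vertex is marked: the only one is [s], which is not below the boundary. *)
    by rewrite [LHS](congr1 (@^~ u) (sa 10 isT)) init_arr0 //= inE; case: eqP => //; lia.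
  - case=> d; first by rewrite [X in X <= _](congr1 (@^~ d) (sa 7 isT)) init_arr0.
    by rewrite [X in X <= _]a6; case: ifP.
  - case.
      apply: side_fresh => // c; rewrite [LHS](congr1 (@^~ c) (sa 7 isT)) init_arr0 //.
    have -> : reg st1 (r_cnt false) = 0 by rewrite /st1 /= /upd /= sr // init_reg0.
    by apply: side_hub => // c; rewrite [LHS]a6 jE.
have jT : nth 0 T j \in T by apply: mem_nth; rewrite sT.
have Tj := Ts _ jT.
exists 14, (10 + 24 * (k - j.+1)); split; last lia.
apply: wp_vc => //=; rewrite /upd /= r9 r2 a2.
split; [by split; lia | lia |]; split; [by split; lia | lia |]; split; first by split; lia.
exists j.+1; split.
- by apply: same_trans (conj sr sa) _ (isT : all (mem [:: 9]) [:: 9] && all (mem [:: 6; 11]) [:: 11; 6]); same_tac.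
- by rewrite /= /upd /=; split; lia.
- by move=> c; rewrite /= /upd /= a6 addn1; case: (c =P j.+1) => [->|/eqP ne];
    [rewrite ltnS leqnn | have -> : (0 < c <= j.+1) = (0 < c <= j) by lia].
- move=> u; rewrite /= /upd /= a11 (take_nth 0) ?sT // mem_rcons inE.
  by case: (u =P nth 0 T j) => [->|].
Qed.

Lemma start_linkage_wp (t t' : k.-tuple 'I_n) :
  (forall v, v \in tval t -> v < s) -> (forall v, v \in tval t' -> v <= s) ->
  wp W start_linkage (30 + 25 * k) (fun st =>
    sweep_inv (fun sd => map val (if sd then t else t')) (fun=> 0) s.+1
      (fun c => 0 < c <= k) st /\ reg st 4 = k)
  (input e k s [:: tval t; tval t']).
Proof.
move=> ts ts'; set st0 := input _ _ _ _; set T := map val t; set T' := map val t'.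
have sT : size T = k by rewrite size_map size_tuple.
have sT' : size T' = k by rewrite size_map size_tuple.
have Ts x : x \in T -> x < s by case/mapP => v /ts ? ->.
have Ts' x : x \in T' -> x <= s by case/mapP => v /ts' ? ->.
pose I tm st := exists j, [/\ same [:: 9] [:: 10; 11] st0 st,
  [/\ j <= k, reg st 9 = j & 10 + 24 * (k - j) <= tm],
  forall u, arr st 10 u = (u \in take j T') &
  forall u, arr st 11 u = (u \in take j T)].
apply: (@wp_le _ _ ((10 + 24 * k) + 12)); last lia.
apply: wp_then.
have I0 : I (10 + 24 * k) st0.
  exists 0; split=> //; first by rewrite subn0.
  - by move=> c; rewrite init_arr0 // take0.
  - by move=> u; rewrite init_arr0 // take0.
apply: (wp_while (I := I)) I0 => tm st [j [[sr sa] [jk r9 tt] a10 a11]].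
have r1 : reg st 1 = k by rewrite sr.
have r2 : reg st 2 = s by rewrite sr.
have a2 i : arr st 2 i = nth 0 T i by rewrite sa.
have a3 i : arr st 3 i = nth 0 T' i by rewrite sa.
rewrite /= r9 r1; split; first by split; lia.
case: ltnP => [lt|ge]; last first.
  have jE : j = k by lia.
  split; first lia; apply: wp_vc => //=; rewrite /upd /= r1 r2 addn1.
  split; first by split; lia.
  do 3![split; first lia]; split=> //.
  have gr : graph s k off nb st by split; rewrite ?sr ?sa.
  set st1 := set_reg _ 6 k; have up0 sd u : arr st1 (a_up sd) u = 0.
    by case: sd; rewrite /st1 /= sa // init_arr0.
  have prd0 sd u : arr st1 (a_prd sd) u = 0.
    by case: sd; rewrite /st1 /= sa // init_arr0.
  apply: start_inv => //; first by lia.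
  - by rewrite /st1 /= /upd /= sr // init_reg0.
  - by case=> u us; rewrite [LHS](a11, a10) jE take_oversize ?sT ?sT'.
  - by move=> sd d; rewrite prd0.
  - by move=> x /Ts; lia.
  - case; apply: side_fresh => //; first by move=> x /Ts; lia.
have jT : nth 0 T j \in T by apply: mem_nth; rewrite sT.
have jT' : nth 0 T' j \in T' by apply: mem_nth; rewrite sT'.
have Tj := Ts _ jT; have Tj' := Ts' _ jT'.
exists 14, (10 + 24 * (k - j.+1)); split; last lia.
apply: wp_vc => //=; rewrite /upd /= r9 a2 a3.
split; [by split; lia | lia |]; split; [by split; lia | lia |]; split; first by split; lia.
exists j.+1; split.
- by apply: same_trans (conj sr sa) _ (isT : all (mem [:: 9]) [:: 9] && all (mem [:: 10; 11]) [:: 11; 10]); same_tac.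
- by rewrite /= /upd /=; split; lia.
- move=> u; rewrite /= /upd /= a10 (take_nth 0) ?sT' // mem_rcons inE.
  by case: (u =P nth 0 T' j) => [->|].
- move=> u; rewrite /= /upd /= a11 (take_nth 0) ?sT // mem_rcons inE.
  by case: (u =P nth 0 T j) => [->|].
Qed.

End Paths.

Lemma trees_bound n (e : rel 'I_n) (s : 'I_n) k :
  #|trees_edges e s k| <= n + #|edges e|.
Proof.
by apply: leq_trans (leq_addl _ _); apply/subset_leq_card/trees_edges_sub.
Qed.

(** One statement for both variants: with [h = s] the last conclusion is the fan condition, and with
    [h = 0] it is contradictory, hence vertex-disjointness. *)
Lemma good_paths n (e : rel 'I_n) (s : 'I_n) (A A' : seq 'I_n) h b u u' M :
  symmetric e -> h = 0 \/ h = val s -> uniq M -> (forall x, x \in M -> x <= s) ->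
  links s (lefts e) (map val A) h b u M -> links s (lefts e) (map val A') 0 b u' M ->
  (forall x, settled (map val A) b u x -> settled (map val A') b u' x -> x \in M) ->
  let ps := map (ords s) (map (joined s u u') M) in
  [/\ map (map val) ps = map (joined s u u') M,
      forall p, p \in ps -> exists2 v, v \in A & exists2 w, w \in A' & is_path e v w p
    & forall i j, i < j < size M ->
        forall x, x \in nth [::] ps i -> x \in nth [::] ps j -> h != 0 /\ x = s].
Proof.
move=> e_sym h_top uM Ms lk lk' both ps.
have s_n := ltn_ord s.
have J_n m x : m \in M -> x \in joined s u u' m -> x < n.
  by move=> mM xJ; apply: leq_ltn_trans (joined_le h_top lk lk' Ms mM xJ) s_n.
have insub_mem (B : seq 'I_n) x : x \in map val B -> insubd s x \in B.
  by case/mapP => y yB ->;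
    have -> : insubd s (val y) = y by apply: val_inj; rewrite val_insubd ltn_ord.
split.
- rewrite -map_comp -[RHS]map_id /ps; apply/eq_in_map => p /mapP[m mM ->] /=.
  by apply: ordsK; apply/allP => x /(J_n _ _ mM).
- move=> p; rewrite /ps -map_comp => /mapP[m mM ->] /=.
  have uJ := joined_uniq h_top lk lk' Ms both mM.
  have pJ := joined_path h_top lk lk' Ms mM.
  have fJ := joined_first h_top lk Ms mM.
  have lJ := joined_last u lk' Ms mM.
  have Jn x := J_n m x mM.
  move: pJ fJ lJ uJ Jn; rewrite joinedE /=; set a := last _ _; set q := _ ++ _ => pJ fJ lJ uJ Jn.
  exists (insubd s a); first exact: insub_mem.
  exists (insubd s (last a q)); first exact: insub_mem.
  exact: is_path_ords.
- move=> i j /andP[ij jM] x; have iM := ltn_trans ij jM.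
  rewrite /ps -map_comp !(nth_map 0) // => /mapP[y yi ->] /mapP[z zj] /(congr1 val).
  have [mi mj] := (mem_nth 0 iM, mem_nth 0 jM).
  rewrite !val_insubd (J_n _ _ mi yi) (J_n _ _ mj zj) => yz; rewrite -yz in zj.
  have [/eqP|[yh y0]] := joined_disjoint h_top lk lk' Ms both mi mj yi zj.
    by rewrite nth_uniq //; lia.
  rewrite -yh y0; split=> //; apply: val_inj; rewrite val_insubd.
  by case: h_top => hE; move: y0; rewrite yh hE // ltn_ord.
Qed.

Lemma edges_bound n (e : rel 'I_n) (s : 'I_n) k : k <= size (left_nbrs e s) ->
  [/\ k <= #|edges e|, nedges e <= #|edges e| & val s < n].
Proof.
move=> ks; have mE : nedges e <= #|edges e|.
  by rewrite /nedges size_flatten_nbr; apply: sum_lefts_le.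
split=> //; last exact: ltn_ord.
apply: leq_trans mE; apply: (leq_trans ks).
by rewrite /nedges size_flatten_nbr (bigD1 s) //= size_lefts leq_addr.
Qed.

Definition find_fan := Then start_fan (Then sweep emit).
Definition find_linkage := Then start_linkage (Then sweep emit).

Theorem theorem2 :
  (exists (P : cmd) (C : nat),
    forall (n : nat) (e : rel 'I_n) (s : 'I_n) (k : nat) (t : k.-tuple 'I_n),
      symmetric e -> irreflexive e -> MAO e ->
      0 < s -> 0 < k <= size (left_nbrs e s) ->
      uniq t ->
      (forall i : 'I_k, tree_root e s i <= tnth t i < s) ->
      outputs_paths e P C (input e k s [:: tval t])
        (C * #|trees_edges e s k|) (fan e s t k)
      /\ #|trees_edges e s k| <= n + #|edges e|)
  /\
  (exists (P : cmd) (C : nat),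
    forall (n : nat) (e : rel 'I_n) (s : 'I_n) (k : nat)
           (t s' : k.-tuple 'I_n),
      symmetric e -> irreflexive e -> MAO e ->
      0 < s -> 0 < k <= size (left_nbrs e s) ->
      uniq t -> uniq s' -> [disjoint s' & t] ->
      (forall i : 'I_k, tree_root e s i <= tnth t i < s) ->
      (forall i : 'I_k, tree_root e s i <= tnth s' i <= s) ->
      outputs_paths e P C (input e k s [:: tval t; tval s'])
        (C * #|trees_edges e s k|) (linkage e s' t k)
      /\ #|trees_edges e s k| <= n + #|edges e|).
Proof.
split.
  exists find_fan, 2000 => n e s k t e_sym _ mao s0 k_le ut rt.
  split; last exact: trees_bound.
  have [kE mE sn] := edges_bound (proj2 (andP k_le)).
  have kL : k <= size (lefts e s) by rewrite size_lefts; case/andP: k_le.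
  (* The first vertex below [s] is scanned for [k] colours; as [k] is positive, this absorbs
     constants and terms linear in [k]. *)
  have kw : k <= work (lefts e) s k by case: (val s) s0 => //= v _; apply: leq_addr.
  have wE : work (lefts e) s k <= #|trees_edges e s k| by apply: work_le.
  pose W := 2000 * (n + #|edges e|).+1; have W_big : 3 * (s + k) + nedges e + 20 < W.
    by rewrite /W; move: kE mE sn; rewrite -[val s]/(nat_of_ord s); lia.
  have ts v : v \in tval t -> v < s by case/tnthP => i ->; case/andP: (rt i).
  have rt' (i : 'I_k) : tree_root e s i <= tnth t i by case/andP: (rt i).
  have w1 := start_fan_wp W_big s0 kL ut ts.
  have w : wp W find_fan (2000 * #|trees_edges e s k|)
      (found e s k (fan_starts s t) (fan_hub s)) (input e k s [:: tval t]).
    apply: (@wp_le _ _ ((30 + 25 * k) + (200 + 100 * k + 400 * work (lefts e) s k))); last lia.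
    apply/wp_then/(wp_weaken w1 (leqnn _)) => st [iv r4].
    apply: (run_wp mao W_big _ _ _ (or_intror erefl) erefl (leqnn s) iv r4).
    - by case; rewrite /fan_starts //= map_inj_uniq //; apply: val_inj.
    - by case; rewrite /fan_starts /= ?size_map ?size_tuple; lia.
    - case=> v vs; first exact: (count_starts mao vs rt').
      by rewrite /= ltnNge vs.
  case: w => tm [st' [ex tm_le [M [u [u' [b' [[sM uM Ms] lk lk' both hl]]]]]]].
  have [mapE pP dP] := good_paths (A := [:: s]) e_sym (or_intror erefl) uM Ms lk lk' both.
  exists tm, st', (map (ords s) (map (joined s u u') M)); split=> //; last by rewrite mapE.
  split; first by rewrite !size_map.
    by move=> p /pP[v]; rewrite inE => /eqP -> [w wt wp]; exists w.
  by move=> i j ij x xi xj; have [] := dP i j _ x xi xj; rewrite ?sM.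
exists find_linkage, 2000 => n e s k t s' e_sym _ mao s0 k_le ut us _ rt rs.
split; last exact: trees_bound.
have [kE mE sn] := edges_bound (proj2 (andP k_le)).
have kL : k <= size (lefts e s) by rewrite size_lefts; case/andP: k_le.
have kw : k <= work (lefts e) s k by case: (val s) s0 => //= v _; apply: leq_addr.
have wE : work (lefts e) s k <= #|trees_edges e s k| by apply: work_le.
(* The set variant also scans [s], at the cost of [k] more colours; as [k <= size (lefts e s)], the
   scan range stays [k]. *)
have wS : work (lefts e) s.+1 k = k + work (lefts e) s k by rewrite /= (minn_idPl kL).
pose W := 2000 * (n + #|edges e|).+1; have W_big : 3 * (s + k) + nedges e + 20 < W.
  by rewrite /W; move: kE mE sn; rewrite -[val s]/(nat_of_ord s); lia.
have ts v : v \in tval t -> v < s by case/tnthP => i ->; case/andP: (rt i).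
have ss v : v \in tval s' -> v <= s by case/tnthP => i ->; case/andP: (rs i).
have rt' (i : 'I_k) : tree_root e s i <= tnth t i by case/andP: (rt i).
have rs' (i : 'I_k) : tree_root e s i <= tnth s' i by case/andP: (rs i).
have w1 := start_linkage_wp W_big ts ss.
have w : wp W find_linkage (2000 * #|trees_edges e s k|)
    (found e s k (fun sd => map val (if sd then t else s')) (fun=> 0))
    (input e k s [:: tval t; tval s']).
  apply: (@wp_le _ _ ((30 + 25 * k) + (200 + 100 * k + 400 * work (lefts e) s.+1 k))); last by rewrite wS; lia.
  apply/wp_then/(wp_weaken w1 (leqnn _)) => st [iv r4].
  apply: (run_wp mao W_big _ _ _ (or_introl erefl) erefl (leqnSn s) iv r4).
  - by case; rewrite map_inj_uniq //; apply: val_inj.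
  - by case; rewrite size_map size_tuple.
  - by case=> v vs; [exact: (count_starts mao vs rt') | exact: (count_starts mao vs rs')].
case: w => tm [st' [ex tm_le [M [u [u' [b' [[sM uM Ms] lk lk' both hl]]]]]]].
have [mapE pP dP] := good_paths e_sym (or_introl erefl) uM Ms lk lk' both.
exists tm, st', (map (ords s) (map (joined s u u') M)); split=> //; last by rewrite mapE.
split; [by rewrite !size_map | exact: pP |].
by move=> i j ij x xi xj; have [] := dP i j _ x xi xj; rewrite ?sM.
Qed.
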